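(* Suppose that $f$ is log-concave and symmetric around $1/2$ (i.e., $f(s)=f(1-s)$). Then for each agent $i$ there exists $\tau\ge0$ such that the following mechanism is optimal for agent $i$: $$x_i(s_i,s_{-i})=\begin{cases}0 & s_i\le s_i^{\min}(\tau),\\ \mathbb I\{\mathrm{LR}(s_{-i})\ge\tau\} & s_i^{\min}(\tau)\le s_i\le s_i^{\max}(\tau),\\ \mathbb I\{\mathrm{LR}(s_i,s_{-i})\ge1\} & s_i\ge s_i^{\max}(\tau),\end{cases}$$ where $s_i^{\max}(\tau)=\frac{1}{1+\tau}$ and $$s_i^{\min}(\tau)=\frac{\int\prod_{k\ne i}(1-s_k)\,\mathbb I\{\mathrm{LR}(s_{-i})\ge\tau\}\,d\mathbb F^{\otimes}(s_{-i})}{\int\big(\prod_{k\ne i}s_k+\prod_{k\ne i}(1-s_k)\big)\,\mathbb I\{\mathrm{LR}(s_{-i})\ge\tau\}\,d\mathbb F^{\otimes}(s_{-i})}.$$ In particular the optimal mechanism is deterministic (takes values in $\{0,1\}$).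
   Context: Setup. A state $\omega\in\{-1,+1\}$ is drawn with probability $1/2$ each. There are $n\ge 2$ agents. Conditional on $\omega$, signals $s_1,\dots,s_n$ are i.i.d. with distribution $\mathbb F_\omega$ on $[0,1]$, normalized so that $s_i=\mathbb P[\omega=+1\mid s_i]$. $\mathbb F_{-1},\mathbb F_{+1}$ are mutually absolutely continuous with densities; $\mathbb F=(\mathbb F_{-1}+\mathbb F_{+1})/2$ has density $f$ supported on a non-singleton interval with endpoints $\underline s<\overline s$ in $[0,1]$, differentiable on its support with continuous derivative and $|f'/f|$ bounded. $\mathbb F^{\otimes}(s_{-i})=\prod_{k\ne i}\mathbb F(s_k)$ denotes the product of the unconditional marginals. $\mathrm{LR}(s_{-i})=\prod_{k\ne i}\frac{s_k}{1-s_k}$, $\mathrm{LR}(s_i,s_{-i})=\prod_k\frac{s_k}{1-s_k}$ (likelihood ratios of state $+1$ vs $-1$). A mechanism is measurable $x:[\underline s,\overline s]^n\to[0,1]^n$ ($x_i(s)$ = probability agent $i$ gets a good worth $\omega$ to her, else $0$). Feasibility for agent $i$: for all $s_i,\hat s_i$ in the support, (P) $\mathbb E[\omega x_i(s_i,s_{-i})\mid s_i]\ge0$ and (IC) $\mathbb E[\omega x_i(s_i,s_{-i})\mid s_i]\ge\mathbb E[\omega x_i(\hat s_i,s_{-i})\mid s_i]$. Optimal for agent $i$: maximizes $\mathbb E[x_i(s)]$ subject to (P),(IC). *)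

(* Defs.v *)
From mathcomp Require Import all_boot all_order all_algebra.
From mathcomp Require Import all_classical all_reals all_analysis.
Set Implicit Arguments. Unset Strict Implicit. Unset Printing Implicit Defensive.
Import Order.TTheory GRing.Theory Num.Theory.
Import numFieldNormedType.Exports.
Local Open Scope classical_set_scope.
Local Open Scope ring_scope.

Section Model.
Context {R : realType} (n : nat).

(* signal profiles are handled as functions 'I_n -> R and as n-tuples *)
Definition tup (v : 'I_n -> R) : n.-tuple R := [tuple v j | j < n].

Definition upd (v : 'I_n -> R) (k : nat) (t : R) : 'I_n -> R :=
  fun j => if val j == k then t else v j.

(* Iterated Lebesgue integral over D^(coordinates not skipped): the
   coordinates k < m with ~~ skip k are integrated (coordinate m-1
   outermost), the others keep their value in v. *)
Fixpoint iint (D : set R) (skip : nat -> bool) (m : nat)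
  (g : ('I_n -> R) -> \bar R) (v : 'I_n -> R) : \bar R :=
  match m with
  | 0 => g v
  | m'.+1 => if skip m' then iint D skip m' g v
             else (\int[lebesgue_measure]_(t in D) iint D skip m' g (upd v m' t))%E
  end.

Definition int_others (D : set R) (i : 'I_n) (t : R) (g : ('I_n -> R) -> \bar R) :=
  iint D (fun k => k == val i) n g (fun _ => t).

Definition int_all (D : set R) (g : ('I_n -> R) -> \bar R) :=
  iint D (fun _ => false) n g (fun _ => 0).

(* gp, gm : densities of F_{+1}, F_{-1}; f = (gp + gm)/2 density of F *)
Definition dens (gp gm : R -> R) (s : R) : R := (gp s + gm s) / 2.

Definition prod_others (i : 'I_n) (h : R -> R) (v : 'I_n -> R) : R :=
  \prod_(k < n | k != i) h (v k).

Definition prod_all (h : R -> R) (v : 'I_n -> R) : R := \prod_(k < n) h (v k).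

(* E[ omega * x_i(r, s_{-i}) | s_i = t ]  (Bayes' rule, omega in {-1,+1}
   with prior 1/2 each, signals i.i.d. given omega) *)
Definition condE (a b : R) (gp gm : R -> R) (i : 'I_n)
  (x : n.-tuple R -> R) (t r : R) : \bar R :=
  (((gp t / 2)%:E *
      int_others `[a, b] i r (fun v => (prod_others i gp v * x (tup v))%:E)
    - (gm t / 2)%:E *
      int_others `[a, b] i r (fun v => (prod_others i gm v * x (tup v))%:E))
   * ((dens gp gm t)^-1)%:E)%E.

Definition expected (a b : R) (gp gm : R -> R) (x : n.-tuple R -> R) : \bar R :=
  int_all `[a, b]
    (fun v => ((prod_all gp v + prod_all gm v) / 2 * x (tup v))%:E).

Definition profiles (a b : R) : set (n.-tuple R) :=
  [set s | forall j, tnth s j \in `[a, b]].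

Definition mech_comp (a b : R) (x : n.-tuple R -> R) : Prop :=
  measurable_fun (profiles a b) x /\
  (forall s, profiles a b s -> 0 <= x s <= 1).

Definition feasible (a b : R) (gp gm : R -> R) (i : 'I_n)
  (x : n.-tuple R -> R) : Prop :=
  (forall t, t \in `[a, b] -> (0 <= condE a b gp gm i x t t)%E) /\
  (forall t r, t \in `[a, b] -> r \in `[a, b] ->
     (condE a b gp gm i x t r <= condE a b gp gm i x t t)%E).

Definition optimal_for (a b : R) (gp gm : R -> R) (i : 'I_n)
  (x : n.-tuple R -> R) : Prop :=
  mech_comp a b x /\ feasible a b gp gm i x /\
  forall y, mech_comp a b y -> feasible a b gp gm i y ->
    (expected a b gp gm y <= expected a b gp gm x)%E.

(* LR(s_{-i}) >= tau, written without division: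
   prod_{k<>i} s_k >= tau * prod_{k<>i} (1 - s_k) *)
Definition LR_others_ge (i : 'I_n) (v : 'I_n -> R) (tau : R) : bool :=
  tau * prod_others i (fun s => 1 - s) v <= prod_others i id v.

Definition LR_all_ge1 (v : 'I_n -> R) : bool :=
  prod_all (fun s => 1 - s) v <= prod_all id v.

Definition s_max (tau : R) : R := 1 / (1 + tau).

Definition s_min (a b : R) (gp gm : R -> R) (i : 'I_n) (tau : R) : R :=
  let f := dens gp gm in
  fine (int_others `[a, b] i 0 (fun v =>
          (prod_others i (fun s => (1 - s) * f s) v
           * (LR_others_ge i v tau)%:R)%:E))
  / fine (int_others `[a, b] i 0 (fun v =>
          ((prod_others i (fun s => s * f s) v
            + prod_others i (fun s => (1 - s) * f s) v)
           * (LR_others_ge i v tau)%:R)%:E)).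

Definition x_star (a b : R) (gp gm : R -> R) (i : 'I_n) (tau : R)
  (s : n.-tuple R) : R :=
  let v := tnth s in
  if tnth s i <= s_min a b gp gm i tau then 0
  else if tnth s i <= s_max tau then (LR_others_ge i v tau)%:R
  else (LR_all_ge1 v)%:R.

End Model.

(* Main.v *)
(* The objective and the constraints only involve the interim quantities
   P(r) = E[x_i | s_i = r, omega = 1] and Q(r) = E[x_i | s_i = r, omega = -1].
   Incentive compatibility says that the affine maps t |-> t P(r) - (1 - t) Q(r)
   lie below U(t) = t P(t) - (1 - t) Q(t), so that U is convex with subgradient
   P + Q, and by Neyman-Pearson they also lie below the support lines of the
   first-best payoff, which are given by the tests LR(s_{-i}) >= tau.  Given a
   feasible mechanism, choose tau in [0, 1] such that the support line with
   parameter tau takes the value U(1/2) at 1/2.  Then the payoff of the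
   mechanism with parameter tau is below U on the left of 1/2 and above U on
   the right.  Integrating by parts, the objective is linear in U with weights
   that are nonpositive on the left of 1/2 and nonnegative on the right, because
   f is symmetric and unimodal; hence the mechanism with parameter tau is at
   least as good.  The best tau exists by compactness, as LR(s_{-i}) has no
   atoms. *)
Require Import Defs.
From mathcomp Require Import all_boot all_order all_algebra.
From mathcomp Require Import all_classical all_reals all_analysis.
From mathcomp Require Import measurable_realfun ring lra.
Import Order.TTheory GRing.Theory Num.Theory.
Import numFieldNormedType.Exports.
Local Open Scope classical_set_scope.
Local Open Scope ring_scope.


(** * Iterated integrals of nonnegative functions: measurability, linearity, convergence, exchange
    of order *)

Section IteratedIntegral.
Set Implicit Arguments. Unset Strict Implicit.
Context {R : realType} {n : nat}.
Implicit Types (g : ('I_n -> R) -> \bar R) (v : 'I_n -> R) (D : set R)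
  (skip : nat -> bool).

(** The range [0, 1] for tau is what puts 1/2 between the lower cutoff and [s_max]: there the payoff
    at 1/2 is half the difference of the two state-dependent probabilities of LR(s_{-i}) >= tau.
    This difference moves continuously from 0 at tau = 0 to its first-best value at tau = 1, so the
    intermediate value theorem reaches every feasible U(1/2). The endpoint tau = 1 is the delicate
    case. The constraint at 1/2 bounds P - Q and Neyman-Pearson bounds P - tau Q; comparing the two
    divides by 1 - tau, and at tau = 1 they say the same thing. A mechanism with first-best payoff
    at 1/2 is therefore scaled down slightly, compared, and recovered in the limit. Integration by
    parts has to work with increments: U is merely convex with a measurable subgradient, and the
    weight enters through its monotonicity on each half. Both identities for U and for the weighted
    integral come from one principle: a function whose increments over [s, t] are at least minus (g
    t - g s) (t - s) is nondecreasing. The absence of atoms is used twice, for the intermediate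
    value theorem and for the continuity of the objective in tau. *)

Definition nnmfun g : Prop :=
  measurable_fun [set: n.-tuple R] (fun s => g (tnth s)) /\
  (forall v, (0 <= g v)%E).

Lemma tnth_tup v : tnth (tup v) = v.
Proof. by apply/funext => j; rewrite tnth_mktuple. Qed.

Lemma tup_tnth (s : n.-tuple R) : tup (tnth s) = s.
Proof. by apply: eq_from_tnth => j; rewrite tnth_mktuple. Qed.

(** The product sigma-algebra lives on tuples, so a map into profiles is measured coordinatewise and
    routed through [tup]. *)
Lemma nnmfun_comp {d} {T : measurableType d} g (F : T -> 'I_n -> R) :
  nnmfun g -> (forall j, measurable_fun [set: T] (fun x => F x j)) ->
  measurable_fun [set: T] (fun x => g (F x)).
Proof.
move=> [mg _] mF.
have -> : (fun x => g (F x)) = (fun s : n.-tuple R => g (tnth s)) \o (@tup R n \o F).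
  by apply/funext => x /=; rewrite tnth_tup.
apply: measurableT_comp => //.
apply/measurable_fun_tnthP => j.
rewrite [X in measurable_fun _ X](_ : _ = fun x => F x j)//.
by apply/funext => x /=; rewrite tnth_mktuple.
Qed.

Lemma measurable_upd {d} {T : measurableType d} (F : T -> 'I_n -> R) k
    (h : T -> R) :
  (forall j, measurable_fun [set: T] (fun x => F x j)) ->
  measurable_fun [set: T] h ->
  forall j, measurable_fun [set: T] (fun x => upd (F x) k (h x) j).
Proof. by move=> mF mh j; rewrite /upd; case: eqP. Qed.

Lemma nnmfun_slice g v k : nnmfun g ->
  measurable_fun [set: R] (fun t => g (upd v k t)).
Proof.
move=> mg; apply: (nnmfun_comp (F := upd v k)) => // j.
exact: (measurable_upd (F := fun=> v)). Qed.

Lemma nnmfun_int D k g : measurable D -> nnmfun g ->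
  nnmfun (fun v => \int[lebesgue_measure]_(t in D) g (upd v k t))%E.
Proof.
move=> mD mg; split; last by move=> v; apply: integral_ge0 => t _; exact: (proj2 mg).
pose T := (n.-tuple R * measurableTypeR R)%type.
pose G (z : T) : \bar R := g (upd (tnth z.1) k z.2).
pose F : T -> \bar R := G \_ (setT `*` D).
rewrite [X in measurable_fun _ X](_ : _ = fubini_F lebesgue_measure F); last first.
  apply/funext => s; rewrite /fubini_F [LHS]integral_mkcond.
  apply: eq_integral => t _; rewrite /F !patchE.
  by congr (if _ then _ else _); rewrite in_setX in_setT.
apply: (@measurable_fun_fubini_tonelli_F _ _ (n.-tuple R) (measurableTypeR R) R lebesgue_measure F) => /=; last first.
  by move=> z; rewrite erestrict_ge0// => x _; exact: (proj2 mg).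
apply/(measurable_restrictT G); first exact: measurableX.
apply: measurable_funTS.
apply: (nnmfun_comp (F := fun z : T => upd (tnth z.1) k z.2)) => // j.
apply: (measurable_upd (F := fun z : T => tnth z.1)) => //.
move=> i.
by apply: (measurableT_comp (f := fun s => tnth s i)) => //; exact: measurable_tnth.
Qed.

Lemma nnmfun_iint D skip m g : measurable D -> nnmfun g -> nnmfun (iint D skip m g).
Proof.
move=> mD mg; elim: m => [//|m ih] /=; case: (skip m) => //.
exact: nnmfun_int.
Qed.

Lemma measurable_iint_upd D E skip m k g v : measurable D -> nnmfun g ->
  measurable_fun E (fun t : R => iint D skip m g (upd v k t)).
Proof.
by move=> mD mg; apply: measurable_funTS; apply: nnmfun_slice; exact: nnmfun_iint.
Qed.

Lemma iint_ge0 D skip m g v : (forall w, 0 <= g w)%E ->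
  (0 <= iint D skip m g v)%E.
Proof.
move=> g0; elim: m v => [//|m ih] v /=; case: (skip m) => //.
by apply: integral_ge0.
Qed.

(* The final values of the integrated coordinates range over D, the other
   coordinates keep the values they have in [v]. *)
Definition reach D (skip : nat -> bool) (m : nat) v : set ('I_n -> R) :=
  [set w | forall k : 'I_n,
    if (k < m)%N && ~~ skip k then D (w k) else w k = v k].

Lemma reach_upd D skip m v t w : ~~ skip m -> D t ->
  reach D skip m (upd v m t) w -> reach D skip m.+1 v w.
Proof.
move=> sm Dt rw k; move: (rw k); rewrite /upd ltnS.
by case: (ltngtP k m) => //= -> ->; rewrite sm.
Qed.

Lemma reach_skip D skip m v w : skip m ->
  reach D skip m v w -> reach D skip m.+1 v w.
Proof.
move=> sm rw k; move: (rw k); rewrite ltnS.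
by case: (ltngtP k m) => //= ->; rewrite sm.
Qed.

Lemma eq_iint D skip m g g' v :
  (forall w, reach D skip m v w -> g w = g' w) ->
  iint D skip m g v = iint D skip m g' v.
Proof.
elim: m v => [|m ih] v gg' /=; first by apply: gg'.
case: ifP => sm; first by apply: ih => w /(reach_skip sm); exact: gg'.
apply: eq_integral => t /set_mem Dt; apply: ih => w rw; apply: gg'.
by apply: reach_upd Dt rw; rewrite sm.
Qed.

Lemma eq_iint_skip D skip skip' m g v :
  (forall k, (k < m)%N -> skip k = skip' k) ->
  iint D skip m g v = iint D skip' m g v.
Proof.
elim: m v => [//|m ih] v e /=; rewrite e//.
have {}ih w : iint D skip m g w = iint D skip' m g w.
  by apply: ih => k km; apply: e; exact: leqW.
by case: (skip' m) => //; apply: eq_integral => t _.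
Qed.

Lemma le_iint D skip m g g' v : measurable D -> nnmfun g -> nnmfun g' ->
  (forall w, reach D skip m v w -> g w <= g' w)%E ->
  (iint D skip m g v <= iint D skip m g' v)%E.
Proof.
move=> mD mg mg'; elim: m v => [|m ih] v gg' /=; first exact: gg'.
case: ifP => sm; first by apply: ih => w /(reach_skip sm); exact: gg'.
apply: ge0_le_integral => //.
- by move=> t _; apply: iint_ge0; exact: (proj2 mg).
- exact: measurable_iint_upd.
- exact: measurable_iint_upd.
- move=> t Dt; apply: ih => w rw; apply: gg'.
  by apply: reach_upd Dt rw; rewrite sm.
Qed.

Lemma iintD D skip m g g' v : measurable D -> nnmfun g -> nnmfun g' ->
  (iint D skip m (fun w => g w + g' w) v =
   iint D skip m g v + iint D skip m g' v)%E.
Proof.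
move=> mD mg mg'; elim: m v => [//|m ih] v /=; case: (skip m) => //.
under eq_integral do rewrite ih.
apply: ge0_integralD => //.
- by move=> t _; apply: iint_ge0; exact: (proj2 mg).
- exact: measurable_iint_upd.
- by move=> t _; apply: iint_ge0; exact: (proj2 mg').
- exact: measurable_iint_upd.
Qed.

Lemma iintZ D skip m g v (c : R) : measurable D -> nnmfun g -> 0 <= c ->
  (iint D skip m (fun w => c%:E * g w) v = c%:E * iint D skip m g v)%E.
Proof.
move=> mD mg c0; elim: m v => [//|m ih] v /=; case: (skip m) => //.
under eq_integral do rewrite ih.
apply: ge0_integralZl => //.
- exact: measurable_iint_upd.
- by move=> t _; apply: iint_ge0; exact: (proj2 mg).
Qed.

(** Monotone convergence, once per integrated coordinate. The hypotheses are confined to [reach]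
    because likelihood-ratio tests are monotone in the threshold only where the factors 1 - s_k are
    nonnegative. *)
Lemma cvg_iint D skip m (F : nat -> ('I_n -> R) -> \bar R) g v :
  measurable D -> (forall k, nnmfun (F k)) -> nnmfun g ->
  (forall w, reach D skip m v w ->
     {homo F^~ w : j k / (j <= k)%N >-> (j <= k)%E}) ->
  (forall w, reach D skip m v w -> F k w @[k --> \oo] --> g w) ->
  iint D skip m (F k) v @[k --> \oo] --> iint D skip m g v.
Proof.
move=> mD mF mg; elim: m v => [|m ih] v ndF Fg /=.
  by apply: Fg => k.
case: ifP => sm.
  by apply: ih => w /(reach_skip sm) rw; [exact: ndF|exact: Fg].
have ru t w : D t -> reach D skip m (upd v m t) w -> reach D skip m.+1 v w.
  by move=> Dt rw; apply: reach_upd Dt rw; rewrite sm.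
have -> : (\int[lebesgue_measure]_(t in D) iint D skip m g (upd v m t) =
    \int[lebesgue_measure]_(t in D)
       limn (fun k => iint D skip m (F k) (upd v m t)))%E; last first.
  apply: cvg_monotone_convergence => //.
  - by move=> k; exact: measurable_iint_upd.
  - by move=> k t _; apply: iint_ge0; exact: (proj2 (mF k)).
  - move=> t Dt j k jk; apply: le_iint => // w rw.
    exact: (ndF w (ru t w Dt rw)).
apply: eq_integral => t /set_mem Dt; apply/esym/cvg_lim => //.
by apply: ih => w /(ru t w Dt) rw; [exact: ndF|exact: Fg].
Qed.

Lemma updC v k l s t : k <> l -> upd (upd v k s) l t = upd (upd v l t) k s.
Proof.
move=> kl; apply/funext => j; rewrite /upd.
by case: eqP => // ->; case: eqP => // /esym.
Qed.

(** Two-variable Tonelli moves coordinate i outward past one layer at a time. This links the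
    objective, which integrates over all signals, to interim quantities with s_i held fixed. *)
Lemma iint_fubini D (i : nat) m g v : measurable D -> nnmfun g -> (i < m)%N ->
  iint D (fun=> false) m g v =
  (\int[lebesgue_measure]_(r in D) iint D (fun k => k == i) m g (upd v i r))%E.
Proof.
move=> mD mg; elim: m v => [//|m ih] v im.
have [mi|mi] := eqVneq m i.
  rewrite /= mi eqxx; apply: eq_integral => r _; apply: eq_iint_skip => k ki.
  by rewrite (ltn_eqF ki).
have {im} im : (i < m)%N by rewrite ltn_neqAle eq_sym mi -ltnS.
rewrite /= (negbTE mi).
under eq_integral do rewrite ih//.
pose T := (measurableTypeR R * measurableTypeR R)%type.
pose H := iint D (fun k => k == i) m g.
have mH : nnmfun H by exact: nnmfun_iint.
pose G (z : T) : \bar R := H (upd (upd v m z.1) i z.2).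
pose F : T -> \bar R := G \_ (D `*` D).
have F0 z : (0 <= F z)%E by rewrite erestrict_ge0// => x _; exact: (proj2 mH).
have mF : measurable_fun setT F.
  apply/(measurable_restrictT G); first exact: measurableX.
  apply: measurable_funTS.
  apply: (nnmfun_comp (F := fun z : T => upd (upd v m z.1) i z.2)) => // j.
  apply: (measurable_upd (F := fun z : T => upd v m z.1)) => //.
  exact: (measurable_upd (F := fun=> v)).
have := @fubini_tonelli _ _ _ _ R lebesgue_measure lebesgue_measure F mF F0.
rewrite [LHS](_ : _ = \int[lebesgue_measure]_(t in D)
    \int[lebesgue_measure]_(r in D) H (upd (upd v m t) i r))%E; last first.
  rewrite [RHS]integral_mkcond; apply: eq_integral => t _.
  rewrite [RHS]patchE [X in if _ then X else _]integral_mkcond.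
  case: ifPn => Dt.
    apply: eq_integral => r _; rewrite /F !patchE in_setX Dt/=.
    by case: ifP.
  by rewrite integral0_eq// => r _; rewrite /F patchE in_setX (negbTE Dt).
move=> ->.
rewrite [RHS]integral_mkcond; apply: eq_integral => r _.
rewrite [RHS]patchE [X in if _ then X else _]integral_mkcond.
case: ifPn => Dr.
  apply: eq_integral => t _; rewrite /F !patchE in_setX Dr andbT/=.
  by case: ifP => // _; rewrite /G /H updC//; exact/eqP.
by rewrite integral0_eq// => t _; rewrite /F patchE in_setX (negbTE Dr) andbF.
Qed.

(** Each layer integrates one factor to 1, so after m layers the factors from index m on remain; at
    m = n none is left. *)
Lemma iint_prod D (i : 'I_n) (h : R -> R) m v :
  measurable D -> measurable_fun setT h -> (forall t, 0 <= h t) ->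
  (\int[lebesgue_measure]_(t in D) (h t)%:E = 1)%E -> (m <= n)%N ->
  iint D (fun k => k == i) m (fun w => (prod_others i h w)%:E) v =
  (\prod_(k < n | (k != i) && (m <= k)%N) h (v k))%:E.
Proof.
move=> mD mh h0 h1; elim: m v => [|m ih] v mn /=.
  by congr EFin; apply: eq_bigl => k; rewrite andbT.
case: ifPn => mi.
  rewrite ih ?(ltnW mn)//; congr EFin; apply: eq_bigl => k.
  case: eqVneq => //= ki; rewrite leq_eqVlt (_ : (m == k) = false)//.
  by apply/eqP => mk; move/eqP: ki; apply; apply: val_inj => /=; rewrite -mk (eqP mi).
pose c := \prod_(k < n | (k != i) && (m < k)%N) h (v k).
have e t : iint D (fun k => k == i) m (fun w => (prod_others i h w)%:E)
    (upd v m t) = (c%:E * (h t)%:E)%E.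
  rewrite ih ?(ltnW mn)// (bigD1 (Ordinal mn)) /=; last by rewrite leqnn andbT.
  rewrite -EFinM mulrC /upd /= eqxx; congr (_ * _)%:E; apply: eq_big => k.
    rewrite [(m < k)%N]ltn_neqAle -(inj_eq val_inj) /= eq_sym.
    by rewrite -andbA; congr (_ && _); rewrite andbC eq_sym.
  by move=> /andP[/andP[_ _] /negbTE]; rewrite -(inj_eq val_inj) /= => ->.
under eq_integral do rewrite e.
rewrite ge0_integralZl ?h1 ?mule1//.
- by apply/measurable_EFinP; exact: measurable_funTS.
- by move=> t _; rewrite lee_fin.
- by rewrite lee_fin; apply: prodr_ge0.
Qed.

End IteratedIntegral.

(** * The likelihood ratio of the other agents has no atoms *)

Section Ties.
Context {R : realType} {n : nat}.
Set Implicit Arguments. Unset Strict Implicit.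
Implicit Types (g : ('I_n -> R) -> \bar R) (v : 'I_n -> R) (D : set R)
  (skip : nat -> bool).

Lemma iint_skip D skip m g v : (forall k, (k < m)%N -> skip k) ->
  iint D skip m g v = g v.
Proof.
move=> sk; elim: m sk => [//|m ih] sk /=.
by rewrite sk// ih// => k km; apply: sk; exact: leqW.
Qed.

(** Here j is the innermost integrated coordinate. Its slices are only known to vanish when the
    outer coordinates are interior, so each layer is first moved to the open interval, which costs a
    null set. *)
Lemma iint_eq0 (a b : R) skip (j : nat) m g v :
  nnmfun g -> (forall k, (k < j)%N -> skip k) -> ~~ skip j ->
  (forall w, (forall k : 'I_n, (j < k)%N -> ~~ skip k -> a < w k < b) ->
    (\int[lebesgue_measure]_(t in `]a, b[) g (upd w j t) = 0)%E) ->
  (j < m)%N -> (forall k : 'I_n, (m <= k)%N -> ~~ skip k -> a < v k < b) ->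
  iint `[a, b] skip m g v = 0%E.
Proof.
move=> mg skj sj g0; elim: m v => [//|m ih] v jm vab.
rewrite /=; case: ifPn => sm.
  apply: ih => [|k]; last first.
    rewrite leq_eqVlt => /predU1P[mk|mk sk]; last exact: vab.
    by rewrite -mk sm.
  rewrite ltn_neqAle -ltnS jm andbT.
  by apply: contraNneq sj => ->.
rewrite (@integral_itv_bndoo _ a b _ true false); last first.
  by apply: measurable_iint_upd.
have [jm'|jm'] := eqVneq j m.
  rewrite -jm' in vab *; under eq_integral do rewrite iint_skip//.
  exact: g0.
apply: integral0_eq => t; rewrite /= in_itv /= => tab; apply: ih => [|k].
  by rewrite ltn_neqAle jm' -ltnS.
rewrite leq_eqVlt /upd => /predU1P[->|mk sk]; first by rewrite eqxx.
by rewrite gtn_eqF//; exact: vab.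
Qed.

Lemma measurable_prod_others (i : 'I_n) (h : R -> R) : measurable_fun setT h ->
  measurable_fun [set: n.-tuple R] (fun s => prod_others i h (tnth s)).
Proof.
move=> mh; rewrite [X in measurable_fun _ X](_ : _ = fun s : n.-tuple R =>
    \prod_(k < n) (if k != i then h (tnth s k) else 1)); last first.
  by apply/funext => s; rewrite /prod_others big_mkcond.
apply: measurable_prod => k _; case: (k != i) => //.
by apply: (measurableT_comp mh); exact: measurable_tnth.
Qed.

Lemma nnmfun_weighted (i : 'I_n) (h : R -> R) (phi : ('I_n -> R) -> R) :
  measurable_fun setT h -> (forall t, 0 <= h t) ->
  measurable_fun [set: n.-tuple R] (fun s => phi (tnth s)) ->
  (forall v, 0 <= phi v) ->
  nnmfun (fun v => (prod_others i h v * phi v)%:E).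
Proof.
move=> mh h0 mphi phi0; split; last first.
  by move=> v; rewrite lee_fin mulr_ge0// prodr_ge0.
apply/measurable_EFinP; apply: measurable_funM => //.
exact: measurable_prod_others.
Qed.

Lemma measurable_natr {d} {T : measurableType d} (f : T -> bool) :
  measurable_fun setT f -> measurable_fun setT (fun x => (f x)%:R : R).
Proof.
move=> mf; rewrite (_ : (fun _ => _) = fun x => if f x then 1 else 0 : R).
  exact: measurable_fun_ifT.
by apply/funext => x; case: (f x).
Qed.

Definition LR_others_eq (i : 'I_n) v (tau : R) : bool :=
  tau * prod_others i (fun s => 1 - s) v == prod_others i id v.

Lemma measurable_prod_othersB (i : 'I_n) (tau : R) :
  measurable_fun [set: n.-tuple R]
    (fun s => tau * prod_others i (fun s => 1 - s) (tnth s)).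
Proof.
apply: measurable_funM => //; apply: measurable_prod_others.
exact: measurable_funB.
Qed.

(** With the remaining signals fixed in (0, 1), a tie is a linear equation t A = tau (1 - t) B in
    one signal t, with A > 0, hence has at most one solution. *)
Lemma iint_LR_others_eq (a b : R) (i : 'I_n) (h : R -> R) (tau r : R) :
  (2 <= n)%N -> 0 <= a -> b <= 1 ->
  measurable_fun setT h -> (forall t, 0 <= h t) ->
  int_others `[a, b] i r
    (fun v => (prod_others i h v * (LR_others_eq i v tau)%:R)%:E) = 0%E.
Proof.
move=> n2 a0 b1 mh h0.
(* The least index other than i: 1 if i = 0, and 0 otherwise. It exists because n >= 2. *)
pose j0 : nat := (i == 0%N :> nat).
have jn : (j0 < n)%N by rewrite (leq_trans _ n2)// /j0; case: (_ == _).
pose j := Ordinal jn.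
have ji : j != i.
  by rewrite -(inj_eq val_inj) /= /j0; case: (nat_of_ord i).
have mg : nnmfun (fun w => (prod_others i h w * (LR_others_eq i w tau)%:R)%:E).
  apply: nnmfun_weighted => //; apply: measurable_natr.
  apply: measurable_fun_eqr; first exact: measurable_prod_othersB.
  exact: measurable_prod_others.
apply: (@iint_eq0 a b _ j0) => //.
- by move=> k; rewrite /j0; case: eqP => //= -> ; rewrite ltnS leqn0.
- move=> w wab.
  pose A := \prod_(k < n | (k != i) && (k != j)) w k.
  pose B := \prod_(k < n | (k != i) && (k != j)) (1 - w k).
  have w01 k : k != i -> k != j -> 0 < w k < 1.
    move=> ki kj; have /andP[aw wb] : a < w k < b.
      apply: wab => //; rewrite ltn_neqAle; apply/andP; split.
        by rewrite eq_sym -[j0]/(val j) (inj_eq val_inj).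
      rewrite /j0; case: eqP => //= i0; rewrite lt0n.
      by rewrite -i0 (inj_eq val_inj).
    by rewrite (le_lt_trans a0 aw) (lt_le_trans wb b1).
  have A0 : 0 < A by apply: prodr_gt0 => k /andP[ki kj]; case/andP: (w01 k ki kj).
  have B0 : 0 < B.
    by apply: prodr_gt0 => k /andP[ki kj]; rewrite subr_gt0; case/andP: (w01 k ki kj).
  have prodE (f : R -> R) t : prod_others i f (upd w j0 t) =
      f t * \prod_(k < n | (k != i) && (k != j)) f (w k).
    rewrite /prod_others (bigD1 j)//= /upd eqxx; congr (_ * _).
    apply: eq_bigr => k /andP[_ /negbTE].
    by rewrite -(inj_eq val_inj) /= => ->.
  rewrite -(@integral_setD1 _ _ (tau * B / (A + tau * B))).
  + apply: integral0_eq => t [_ /= tne].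
    rewrite /LR_others_eq !prodE -/A -/B.
    case: eqP => [e|]; last by rewrite mulr0.
    exfalso; apply: tne.
    have e' : t * (A + tau * B) = tau * B by rewrite mulrDr -e; ring.
    (* For negative tau the sum can vanish, but then the tie equation would force A = 0. *)
    have nz : A + tau * B != 0.
      apply/eqP => z; move: e'; rewrite z mulr0 => tB.
      by move: z; rewrite -tB addr0 => z; rewrite z ltxx in A0.
    by rewrite -[t](mulfK nz) e'.
  + exact: measurableD.
  + exact: (measurable_funTS (nnmfun_slice w j0 mg)).
- by move=> k; rewrite leqNgt ltn_ord.
Qed.

End Ties.

(** * Distribution of the likelihood ratio in each state and its continuity *)

Section Tails.
Context {R : realType} {n : nat}.
Set Implicit Arguments. Unset Strict Implicit.
Implicit Types (g : ('I_n -> R) -> \bar R) (v : 'I_n -> R) (D : set R)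
  (skip : nat -> bool) (phi psi : ('I_n -> R) -> R).

Lemma iint_base D skip m g v v' :
  (forall w w', (forall k : 'I_n, ~~ skip k -> w k = w' k) -> g w = g w') ->
  (forall k : 'I_n, (m <= k)%N -> ~~ skip k -> v k = v' k) ->
  iint D skip m g v = iint D skip m g v'.
Proof.
move=> gg; elim: m v v' => [|m ih] v v' vv' /=.
  by apply: gg => k; exact: vv'.
case: ifP => sm.
  apply: ih => k; rewrite leq_eqVlt => /predU1P[<-|]; first by rewrite sm.
  exact: vv'.
apply: eq_integral => t _; apply: ih => k; rewrite /upd.
by rewrite leq_eqVlt => /predU1P[->|mk sk]; [rewrite eqxx|rewrite vv'].
Qed.

Definition mweight phi : Prop :=
  measurable_fun [set: n.-tuple R] (fun s => phi (tnth s)) /\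
  (forall v, 0 <= phi v <= 1).

Section Weighted.
Variables (a b : R) (i : 'I_n) (h : R -> R).
Hypotheses (mh : measurable_fun setT h) (h0 : forall t, 0 <= h t)
  (h1 : (\int[lebesgue_measure]_(t in `[a, b]) (h t)%:E = 1)%E).

(** With [h] equal to [gp] or [gm], the conditional expectation of [phi] given s_i = r and the
    state. *)
Definition wint (r : R) phi : \bar R :=
  int_others `[a, b] i r (fun v => (prod_others i h v * phi v)%:E).

Lemma nnmfun_mweight phi : mweight phi ->
  nnmfun (fun v => (prod_others i h v * phi v)%:E).
Proof. by move=> [mphi p01]; apply: nnmfun_weighted => // v; case/andP: (p01 v). Qed.

Lemma mweight_cst1 : mweight (fun=> 1).
Proof. by split => // v; rewrite ler01 lexx. Qed.

Lemma wint1 r : wint r (fun=> 1) = 1%E.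
Proof.
rewrite /wint /int_others.
under [X in iint _ _ _ X _]eq_fun do rewrite mulr1.
rewrite iint_prod// big_pred0// => k.
by rewrite leqNgt ltn_ord andbF.
Qed.

Lemma reach_others r v : reach `[a, b] (fun k => k == val i) n (fun=> r) v ->
  (forall k : 'I_n, k != i -> a <= v k <= b) /\ v i = r.
Proof.
move=> rv; split=> [k ki|]; last by move: (rv i) => /=; rewrite eqxx andbF.
move: (rv k) => /=; rewrite ltn_ord.
case: eqP => [/val_inj e|_]; first by rewrite e eqxx in ki.
by rewrite /= in_itv.
Qed.

Lemma le_wint r phi psi : mweight phi -> mweight psi ->
  (forall v, (forall k : 'I_n, k != i -> a <= v k <= b) -> v i = r ->
     phi v <= psi v) -> (wint r phi <= wint r psi)%E.
Proof.
move=> mp mq pq; apply: le_iint => //; try exact: nnmfun_mweight.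
move=> w /reach_others[wab wi].
by rewrite lee_fin ler_wpM2l// ?prodr_ge0//; apply: pq.
Qed.

Lemma wint_ge0 r phi : mweight phi -> (0 <= wint r phi)%E.
Proof. by move=> mp; apply: iint_ge0; exact: (proj2 (nnmfun_mweight mp)). Qed.

Lemma wint_le1 r phi : mweight phi -> (wint r phi <= 1)%E.
Proof.
move=> mp; rewrite -(wint1 r); apply: le_wint => //; first exact: mweight_cst1.
by move=> v _ _; case/andP: ((proj2 mp) v).
Qed.

Lemma wint_fin r phi : mweight phi -> (wint r phi \is a fin_num)%E.
Proof.
move=> mp; rewrite ge0_fin_numE ?wint_ge0//.
by rewrite (le_lt_trans (wint_le1 r mp))// ltry.
Qed.

Lemma wintD r phi psi : mweight phi -> mweight psi ->
  (wint r phi + wint r psi)%E = wint r (fun v => phi v + psi v).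
Proof.
move=> mp mq; rewrite /wint /int_others -iintD//; try exact: nnmfun_mweight.
by congr iint; apply/funext => w; rewrite mulrDr EFinD.
Qed.

Lemma mweight_bool (B : ('I_n -> R) -> bool) :
  measurable_fun [set: n.-tuple R] (fun s => B (tnth s)) ->
  mweight (fun v => (B v)%:R).
Proof.
move=> mB; split; first exact: measurable_natr.
by move=> v; case: (B v); rewrite /= ?ler01 lexx.
Qed.

Lemma mweight_LR tau : mweight (fun v => (LR_others_ge i v tau)%:R).
Proof.
apply: mweight_bool; apply: measurable_fun_ler.
  exact: measurable_prod_othersB.
exact: measurable_prod_others.
Qed.

(** The probability of LR(s_{-i}) >= tau in the state with density [h]. The value 0 for s_i is
    arbitrary, see [tailE]. *)
Definition tail (tau : R) : R := fine (wint 0 (fun v => (LR_others_ge i v tau)%:R)).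

Lemma tailE r tau : wint r (fun v => (LR_others_ge i v tau)%:R) = (tail tau)%:E.
Proof.
rewrite /tail fineK; last exact: wint_fin (mweight_LR tau).
apply: iint_base => [w w' ww'|k]; last by rewrite leqNgt ltn_ord.
have e f : prod_others i f w = prod_others i f w'.
  by apply: eq_bigr => k ki; rewrite ww'.
by rewrite /LR_others_ge !e.
Qed.

Lemma tail_ge0 tau : 0 <= tail tau.
Proof. by rewrite fine_ge0// wint_ge0//; exact: mweight_LR. Qed.

Lemma tail_le1 tau : tail tau <= 1.
Proof. by rewrite -lee_fin -(tailE 0) wint_le1//; exact: mweight_LR. Qed.

Hypotheses (a0 : 0 <= a) (b1 : b <= 1).

Lemma prod_others_itv v : (forall k : 'I_n, k != i -> a <= v k <= b) ->
  0 <= prod_others i id v /\ 0 <= prod_others i (fun s => 1 - s) v.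
Proof.
move=> vab; split; apply: prodr_ge0 => k /vab/andP[av vb].
  exact: le_trans av.
by rewrite subr_ge0 (le_trans vb).
Qed.

Lemma tail0 : tail 0 = 1.
Proof.
apply: EFin_inj; rewrite -(tailE 0) -(wint1 0); apply/eqP; rewrite eq_le.
apply/andP; split; apply: le_wint => //;
  try exact: mweight_LR; try exact: mweight_cst1.
  by move=> v _ _; case: LR_others_ge; rewrite /= ?ler01.
by move=> v /prod_others_itv[A0 _] _; rewrite /LR_others_ge mul0r A0.
Qed.

Lemma tail_nonincreasing : {homo tail : s t / s <= t >-> t <= s}.
Proof.
move=> s t st; rewrite -lee_fin -!(tailE 0).
apply: le_wint => [||v /prod_others_itv[_ B0] _]; try exact: mweight_LR.
rewrite ler_nat /LR_others_ge.
case: (leP (t * _)) => //= tA; rewrite (le_trans _ tA)//.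
exact: ler_wpM2r.
Qed.

Hypothesis n2 : (2 <= n)%N.

(** The events LR >= tau + 1/(k+1) increase to LR > tau, which differs from LR >= tau by the null
    set of ties. *)
Lemma cvg_tail_r tau : tail (tau + k.+1%:R^-1) @[k --> \oo] --> tail tau.
Proof.
(* Where the product of the 1 - s_k is 0 the ratio counts as infinite: the test then holds at every
   threshold, which the second disjunct records. *)
pose g v : R := ((tau * prod_others i (fun s => 1 - s) v < prod_others i id v)
  || (prod_others i (fun s => 1 - s) v == 0))%:R.
have mg : mweight g.
  apply: mweight_bool; apply: measurable_or.
    apply: measurable_fun_ltr; first exact: measurable_prod_othersB.
    exact: measurable_prod_others.
  apply: measurable_fun_eqr => //; apply: measurable_prod_others.
  exact: measurable_funB.
have mt := mweight_LR.
have gt : wint 0 g = (tail tau)%:E.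
  rewrite -(tailE 0); apply/eqP; rewrite eq_le; apply/andP; split.
    apply: le_wint => // v /prod_others_itv[A0 _] _.
    rewrite ler_nat /LR_others_ge.
    by case: ltP => [/ltW ->//|_]; case: eqP => //= ->; rewrite mulr0 A0.
  have me : mweight (fun v => (LR_others_eq i v tau)%:R).
    apply: mweight_bool.
    apply: measurable_fun_eqr; first exact: measurable_prod_othersB.
    exact: measurable_prod_others.
  rewrite -[leRHS]adde0.
  rewrite -[X in (_ + X)%E](iint_LR_others_eq i tau 0 n2 a0 b1 mh h0).
  rewrite wintD//; apply: le_iint => //.
  + exact: nnmfun_mweight.
  + apply: nnmfun_weighted => //.
      apply: measurable_funD; [exact: (proj1 mg)|exact: (proj1 me)].
    by move=> v; rewrite addr_ge0// ler0n.
  move=> v _; rewrite lee_fin ler_wpM2l ?prodr_ge0//.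
  rewrite /g /LR_others_ge /LR_others_eq -natrD ler_nat.
  rewrite le_eqVlt; case: (_ == prod_others i id v); case: (_ < _) => //=.
  by rewrite addn1.
apply: fine_cvg => /=; rewrite /= -/(tail tau) -gt.
apply: cvg_iint => //; first by move=> k; exact: nnmfun_mweight.
- exact: nnmfun_mweight.
- move=> w /reach_others[/prod_others_itv[A0 B0] _] j k jk.
  rewrite lee_fin ler_wpM2l ?prodr_ge0//.
  rewrite ler_nat /LR_others_ge; case: (leP (_ * _)) => //= tA.
  rewrite (le_trans _ tA)// ler_wpM2r// lerD2l lef_pV2 ?posrE//.
  by rewrite ler_nat.
- move=> w /reach_others[/prod_others_itv[A0 B0] _].
  apply/cvg_EFin; first exact: nearW.
  apply: cvgM; first exact: cvg_cst.
  apply: cvg_near_cst; rewrite /g /LR_others_ge.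
  have [->|Bn0] := eqVneq (prod_others i (fun s => 1 - s) w) 0.
    by apply: nearW => k; rewrite mulr0 A0 orbT.
  have {Bn0} B0 : 0 < prod_others i (fun s => 1 - s) w by rewrite lt_neqAle eq_sym Bn0.
  have [tA|tA] := ltP (tau * _); last first.
    apply: nearW => k; rewrite leNgt (le_lt_trans tA)//= ltr_pM2r//.
    by rewrite ltrDl.
  have e0 : 0 < (prod_others i id w - tau * prod_others i (fun s => 1 - s) w) /
      prod_others i (fun s => 1 - s) w by rewrite divr_gt0// subr_gt0.
  near=> k; rewrite (_ : (_ <= _) = true)//.
  rewrite mulrDl -lerBrDl -ler_pdivlMr//; apply/ltW.
  by near: k; exact: (near_infty_natSinv_lt (PosNum e0)).
Unshelve. all: by end_near. Qed.

(** The events LR >= tau - 1/(k+1) decrease to LR >= tau, so monotone convergence is applied to the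
    complements [c]; ties do not interfere on this side. *)
Lemma cvg_tail_l tau : tail (tau - k.+1%:R^-1) @[k --> \oo] --> tail tau.
Proof.
pose c sigma v : R := (~~ LR_others_ge i v sigma)%:R.
have mt := mweight_LR.
have mc sigma : mweight (c sigma).
  apply: mweight_bool; apply: measurable_neg; apply: measurable_fun_ler.
    exact: measurable_prod_othersB.
  exact: measurable_prod_others.
have cE sigma : (fine (wint 0 (c sigma)) = 1 - tail sigma).
  have := wintD 0 (mc sigma) (mt sigma).
  have -> : (fun v => c sigma v + (LR_others_ge i v sigma)%:R) = fun=> 1.
    by apply/funext => v; rewrite /c; case: LR_others_ge; rewrite /= ?addr0 ?add0r.
  rewrite wint1 tailE -(fineK (wint_fin 0 (mc sigma))) -EFinD => -[<-].
  by rewrite addrK.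
suff cv : (1 - tail (tau - k.+1%:R^-1)) @[k --> \oo] --> 1 - tail tau.
  rewrite -[tail tau](subKr 1).
  under [X in X @ _]eq_fun do rewrite -[tail _](subKr 1).
  by apply: cvgB => //; exact: cvg_cst.
rewrite -cE; under [X in X @ _]eq_fun do rewrite -cE.
apply: fine_cvg; rewrite fineK; last exact: wint_fin.
apply: cvg_iint => //; try by move=> *; exact: nnmfun_mweight.
- move=> w /reach_others[/prod_others_itv[A0 B0] _] j k jk.
  rewrite lee_fin ler_wpM2l ?prodr_ge0// /c.
  rewrite ler_nat /LR_others_ge -!ltNge; case: (ltP _ (_ * _)) => //= tA.
  rewrite (lt_le_trans tA)// ler_wpM2r// lerD2l lerN2 lef_pV2 ?posrE//.
  by rewrite ler_nat.
- move=> w /reach_others[/prod_others_itv[A0 B0] _].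
  apply/cvg_EFin; first exact: nearW.
  apply: cvgM; first exact: cvg_cst.
  apply: cvg_near_cst; rewrite /c /LR_others_ge.
  have [->|Bn0] := eqVneq (prod_others i (fun s => 1 - s) w) 0.
    by apply: nearW => k; rewrite !mulr0.
  have {Bn0} B0 : 0 < prod_others i (fun s => 1 - s) w by rewrite lt_neqAle eq_sym Bn0.
  have [tA|tA] := leP (tau * _).
    apply: nearW => k; rewrite (le_trans _ tA)// ler_wpM2r ?(ltW B0)//.
    by rewrite gerBl.
  have e0 : 0 < (tau * prod_others i (fun s => 1 - s) w - prod_others i id w) /
      prod_others i (fun s => 1 - s) w by rewrite divr_gt0// subr_gt0.
  near=> k; rewrite -ltNge (_ : (_ < _) = true)//.
  rewrite mulrBl ltrBrDr -ltrBrDl -ltr_pdivlMr//.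
  by near: k; exact: (near_infty_natSinv_lt (PosNum e0)).
Unshelve. all: by end_near. Qed.

(** By monotonicity, closeness at one point on each side of tau controls a whole neighbourhood. *)
Lemma continuous_tail : continuous tail.
Proof.
move=> tau; apply/cvgrPdist_lt => e e0.
have /cvgrPdist_lt/(_ e e0) [N1 _ h1'] := @cvg_tail_r tau.
have /cvgrPdist_lt/(_ e e0) [N2 _ h2'] := @cvg_tail_l tau.
have {}h1' := h1' N1 (leqnn _); have {}h2' := h2' N2 (leqnn _).
have tI : tau \in `]tau - N2.+1%:R^-1, tau + N1.+1%:R^-1[.
  by rewrite in_itv /= ltrDl gtrBl !invr_gt0 !ltr0n.
near=> t.
have : t \in `]tau - N2.+1%:R^-1, tau + N1.+1%:R^-1[.
  by near: t; exact: near_in_itvoo.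
rewrite in_itv /= => /andP[/ltW t2 /ltW t1].
move: h1' h2' => /=; rewrite !ltr_norml => /andP[_ h1'] /andP[h2' _].
have := tail_nonincreasing t1; have := tail_nonincreasing t2.
by move=> q1 q2; apply/andP; split; lra.
Unshelve. all: by end_near. Qed.

End Weighted.
End Tails.

(** * Monotonicity from increments, integrals of subgradients, integration by parts *)

Section IncrementsAndIntegrals.
Context {R : realType}.
Set Implicit Arguments. Unset Strict Implicit.
Notation mu := (@lebesgue_measure R).

(* Splitting [x, y] into halves k times improves the lower bound on the
   increment of F by a factor 2 ^ k. *)
Lemma increments_ge0 (F g : R -> R) (x y : R) : x <= y ->
  (forall s t, x <= s -> s <= t -> t <= y ->
     - ((g t - g s) * (t - s)) <= F t - F s) ->
  F x <= F y.
Proof.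
move=> xy hF.
have key k : forall s t, x <= s -> s <= t -> t <= y ->
    - ((g t - g s) * (t - s)) <= (F t - F s) * 2 ^+ k.
  elim: k => [|k ih] s t xs st ty; first by rewrite expr0 mulr1; exact: hF.
  pose m := (s + t) / 2.
  have sm : s <= m by rewrite /m; lra.
  have mt : m <= t by rewrite /m; lra.
  have h1 := ih s m xs sm (le_trans mt ty).
  have h2 := ih m t (le_trans xs sm) mt ty.
  have -> : (F t - F s) * 2 ^+ k.+1 =
    2 * ((F t - F m) * 2 ^+ k + (F m - F s) * 2 ^+ k) by rewrite exprS; ring.
  have -> : - ((g t - g s) * (t - s)) =
    2 * (- ((g t - g m) * (t - m)) + - ((g m - g s) * (m - s))).
    by rewrite /m; field.
  by rewrite ler_pM2l// lerD.
rewrite leNgt; apply/negP => Fyx.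
pose c := (g y - g x) * (y - x).
have c0 : 0 <= c / (F x - F y).
  rewrite divr_ge0//; last by rewrite subr_ge0 ltW.
  have := hF x y (lexx _) xy (lexx _); rewrite -/c.
  have : F y - F x < 0 by rewrite subr_lt0.
  lra.
have := archi_boundP c0; set k := Num.Def.archi_bound _ => ck.
have := key k x y (lexx _) xy (lexx _); rewrite -/c; apply/negP; rewrite -ltNge.
rewrite ltrNr -mulNr opprB mulrC -ltr_pdivrMr ?subr_gt0//.
by apply: (lt_trans ck); rewrite -natrX ltr_nat ltn_expl.
Qed.

Lemma integrable_itv (f : R -> R) (M x y : R) :
  measurable_fun `[x, y] f -> (forall t, t \in `[x, y] -> `|f t| <= M) ->
  mu.-integrable `[x, y] (EFin \o f).
Proof.
move=> mf fM; apply: measurable_bounded_integrable => //.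
  by rewrite /= lebesgue_measure_itv /=; case: ifP => // _; rewrite ltry.
exists M; split; first exact: num_real.
by move=> z Mz t /= tI; rewrite (le_trans (fM t tI))// ltW.
Qed.

Lemma Rintegral_split (f : R -> R) (x y z : R) : x <= y -> y <= z ->
  mu.-integrable `[x, z] (EFin \o f) ->
  \int[mu]_(t in `[x, z]) f t =
  \int[mu]_(t in `[x, y]) f t + \int[mu]_(t in `[y, z]) f t.
Proof.
move=> xy yz fi.
have := @Rintegral_itvB _ f (BLeft x) (BRight z) y fi.
rewrite !bnd_simp => /(_ xy yz) e.
rewrite -(@Rintegral_itv_obnd_cbnd _ y) -?e ?subrKC//.
by apply: integrableS fi => //= t /=; rewrite !in_itv /= => /andP[yt ->];
  rewrite (le_trans xy (ltW yt)).
Qed.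

Lemma Rintegral_cst_itv (c x y : R) : x <= y ->
  \int[mu]_(t in `[x, y]) c = c * (y - x).
Proof.
move=> xy; rewrite Rintegral_cst//= lebesgue_measure_itv /= lte_fin.
move: xy; rewrite le_eqVlt => /predU1P[->|xy]; first by rewrite ltxx subrr.
by rewrite xy.
Qed.

Lemma le_Rintegral_itv (f : R -> R) (c x y : R) : x <= y ->
  mu.-integrable `[x, y] (EFin \o f) ->
  (forall t, t \in `[x, y] -> f t <= c) ->
  \int[mu]_(t in `[x, y]) f t <= c * (y - x).
Proof.
move=> xy fi fc; rewrite -(Rintegral_cst_itv c xy).
apply: le_Rintegral => //.
by apply: (@integrable_itv _ `|c|) => //; exact: measurable_cst.
Qed.

Lemma ge_Rintegral_itv (f : R -> R) (c x y : R) : x <= y ->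
  mu.-integrable `[x, y] (EFin \o f) ->
  (forall t, t \in `[x, y] -> c <= f t) ->
  c * (y - x) <= \int[mu]_(t in `[x, y]) f t.
Proof.
move=> xy fi fc; rewrite -(Rintegral_cst_itv c xy).
apply: le_Rintegral => //.
by apply: (@integrable_itv _ `|c|) => //; exact: measurable_cst.
Qed.

Lemma sub_itvcc (l u x y : R) : l <= x -> y <= u -> `[x, y] `<=` `[l, u].
Proof.
move=> lx yu t /=; rewrite !in_itv /= => /andP[xt ty].
by rewrite (le_trans lx xt) (le_trans ty yu).
Qed.

(** A subgradient is nondecreasing, and on [s, t] both the integral of S and the increment of U lie
    between S s (t - s) and S t (t - s). Their difference is thus at most (S t - S s) (t - s), and
    [increments_ge0] applies to it with either sign. *)
Lemma subgradient_integral (U S : R -> R) (l u x y C : R) :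
  measurable_fun `[l, u] S -> (forall t, t \in `[l, u] -> `|S t| <= C) ->
  (forall s t, s \in `[l, u] -> t \in `[l, u] ->
     U s + S s * (t - s) <= U t) ->
  l <= x -> x <= y -> y <= u ->
  \int[mu]_(t in `[x, y]) S t = U y - U x.
Proof.
move=> mS bS sub lx xy yu.
have int s t : l <= s -> t <= u -> mu.-integrable `[s, t] (EFin \o S).
  move=> ls tu; have st := sub_itvcc ls tu.
  apply: (@integrable_itv _ C) => [|z zst]; first exact: measurable_funS mS.
  by apply: bS; exact: st.
have iS s t : l <= s -> s <= t -> t <= u ->
    S s * (t - s) <= \int[mu]_(z in `[s, t]) S z <= S t * (t - s).
  move=> ls st tu.
  have sl z : s <= z -> z <= t -> z \in `[l, u].
    by move=> sz zt; rewrite in_itv /= (le_trans ls sz) (le_trans zt tu).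
  have mono v w : s <= v -> v <= w -> w <= t -> S v <= S w.
    move=> sv; rewrite le_eqVlt => /predU1P[->//|vw wt].
    have vi := sl v sv (le_trans (ltW vw) wt).
    have wi := sl w (le_trans sv (ltW vw)) wt.
    have h1 := sub v w vi wi; have h2 := sub w v wi vi.
    rewrite -(ler_pM2r (_ : 0 < w - v)) ?subr_gt0//; lra.
  apply/andP; split.
    apply: ge_Rintegral_itv => //; first exact: int.
    by move=> z; rewrite in_itv => /andP[sz zt]; exact: mono.
  apply: le_Rintegral_itv => //; first exact: int.
  by move=> z; rewrite in_itv => /andP[sz zt]; exact: mono.
(* Here e is a sign, so that one argument covers both inequalities. *)
have main (e : R) : e ^+ 2 = 1 ->
    e * (\int[mu]_(z in `[x, x]) S z - U x) <=
    e * (\int[mu]_(z in `[x, y]) S z - U y).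
  move=> e1; apply: (@increments_ge0 (fun t => e * (_ - U t)) S) => //.
  move=> s t xs st ty; have ls := le_trans lx xs; have tu := le_trans ty yu.
  rewrite (Rintegral_split xs st); last exact: int.
  have /andP[i1 i2] := iS s t ls st tu.
  have si : s \in `[l, u] by rewrite in_itv /= ls (le_trans st tu).
  have ti : t \in `[l, u] by rewrite in_itv /= tu (le_trans ls st).
  have u1 := sub s t si ti; have u2 := sub t s ti si.
  have /orP[/eqP->|/eqP->] : (e == 1) || (e == -1) by rewrite -sqrf_eq1 e1.
    by lra.
  by lra.
have z0 : \int[mu]_(z in `[x, x]) S z = 0.
  by rewrite set_itv1 Rintegral_set1.
have e2 : (-1 : R) ^+ 2 = 1 by rewrite sqrrN expr1n.
have := main 1 (expr1n _ _); have := main (-1) e2; rewrite z0 => h1 h2.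
by apply/eqP; rewrite eq_le; apply/andP; split; lra.
Qed.

(* Integration by parts for the increment e of D, with h of bounded
   variation only: the increment of the difference of both sides over a small
   interval is at least -C times the increment of g. *)
Lemma by_parts_ge (h e D g : R -> R) (l u C M : R) : l <= u ->
  measurable_fun `[l, u] h -> measurable_fun `[l, u] e ->
  (forall t, t \in `[l, u] -> `|h t| <= M) ->
  (forall t, t \in `[l, u] -> `|e t| <= C) ->
  (forall x y, l <= x -> x <= y -> y <= u ->
     \int[mu]_(t in `[x, y]) e t = D y - D x) ->
  (forall x t y, l <= x -> x <= t -> t <= y -> y <= u ->
     `|h t - h y| <= g y - g x) ->
  (forall x y, l <= x -> x <= y -> y <= u -> (h y - h x) * D x <= 0) ->
  h u * D u - h l * D l <= \int[mu]_(t in `[l, u]) (h t * e t).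
Proof.
move=> lu mh me bh be ie hg hD.
have mS s t : l <= s -> t <= u -> forall f : R -> R, measurable_fun `[l, u] f ->
    measurable_fun `[s, t] f.
  by move=> ls tu f; apply: measurable_funS => //; exact: sub_itvcc.
have C0 : 0 <= C.
  by apply: le_trans (normr_ge0 _) (be l _); rewrite in_itv /= lexx lu.
have int s t : l <= s -> t <= u ->
    mu.-integrable `[s, t] (EFin \o (fun t => h t * e t)).
  move=> ls tu; apply: (@integrable_itv _ (M * C)) => [|z zst].
    by apply: measurable_funM; exact: mS.
  have zl := sub_itvcc ls tu zst.
  by rewrite normrM ler_pM//; [exact: bh|exact: be].
have inte s t : l <= s -> t <= u -> mu.-integrable `[s, t] (EFin \o e).
  move=> ls tu; apply: (@integrable_itv _ C) => [|z zst]; first exact: mS.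
  exact: be (sub_itvcc ls tu zst).
pose F x := \int[mu]_(t in `[l, x]) (h t * e t) - h x * D x.
suff : F l <= F u.
  by rewrite /F set_itv1 Rintegral_set1; lra.
apply: (@increments_ge0 F (fun x => C * g x)) => // s t ls st tu.
rewrite /F (Rintegral_split ls st); last exact: int.
suff : - ((C * g t - C * g s) * (t - s)) <=
    \int[mu]_(z in `[s, t]) (h z * e z) - h t * (D t - D s).
  have := hD s t ls st tu; lra.
rewrite -ie// -RintegralZl//; last exact: inte.
rewrite -RintegralB//; last 2 first.
  exact: int.
  apply: (@integrable_itv _ (`|h t| * C)) => [|z zst].
    by apply: measurable_funM => //; exact: mS.
  by rewrite normrM ler_pM//; exact: be (sub_itvcc ls tu zst).
rewrite -mulNr; apply: ge_Rintegral_itv => //.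
  apply: (@integrable_itv _ (M * C + `|h t| * C)) => [|z zst].
    by apply: measurable_funB; apply: measurable_funM => //; exact: mS.
  have zl := sub_itvcc ls tu zst.
  rewrite (le_trans (ler_normB _ _))// !normrM lerD// ler_pM//.
  - exact: bh.
  - exact: be.
  - exact: be.
move=> z; rewrite in_itv /= => /andP[sz zt].
have zl : z \in `[l, u] by rewrite in_itv /= (le_trans ls sz) (le_trans zt tu).
have : `|(h z - h t) * e z| <= C * g t - C * g s.
  rewrite normrM -mulrBr mulrC ler_pM//; first exact: be.
  exact: hg.
by rewrite ler_norml mulrBl => /andP[].
Qed.

End IncrementsAndIntegrals.

(** * The screening problem of one agent: comparing payoffs that cross at 1/2 *)

Section Screening.
Context {R : realType}.
Set Implicit Arguments. Unset Strict Implicit.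
Notation mu := (@lebesgue_measure R).

Variables (a b : R) (f : R -> R).
Hypotheses (a0 : 0 <= a) (ab : a < b) (b1 : b <= 1) (abE : a + b = 1).
Hypotheses (mf : measurable_fun setT f) (f0 : forall t, 0 <= f t)
  (f_incr : forall s t, a <= s -> s <= t -> t <= 1 / 2 -> f s <= f t)
  (f_decr : forall s t, 1 / 2 <= s -> s <= t -> t <= b -> f t <= f s).

Definition rule (P : R -> R) : Prop :=
  measurable_fun `[a, b] P /\ (forall t, t \in `[a, b] -> 0 <= P t <= 1).

Definition payoff (P Q : R -> R) (t : R) : R := t * P t - (1 - t) * Q t.

Definition incentive (P Q : R -> R) : Prop := forall t r,
  t \in `[a, b] -> r \in `[a, b] -> t * P r - (1 - t) * Q r <= payoff P Q t.

Definition objective (P Q : R -> R) : R :=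
  \int[mu]_(t in `[a, b]) (f t * (t * P t + (1 - t) * Q t)).

Let h (t : R) : R := 2 * t * (1 - t) * f t.

Lemma f_le_half t : t \in `[a, b] -> f t <= f (1 / 2).
Proof.
rewrite in_itv /= => /andP[at_ tb].
have [t2|t2] := leP t (1 / 2); first exact: f_incr.
by apply: f_decr => //; exact: ltW.
Qed.

Lemma rule_norm P t : rule P -> t \in `[a, b] -> `|P t| <= 1.
Proof. by move=> [_ P01] /P01/andP[P0 P1]; rewrite ger0_norm. Qed.

Lemma itv01 t : t \in `[a, b] -> 0 <= t <= 1.
Proof.
by rewrite in_itv /= => /andP[at_ tb]; rewrite (le_trans a0 at_) (le_trans tb b1).
Qed.

Lemma measurable_objective P Q : rule P -> rule Q ->
  measurable_fun `[a, b] (fun t => f t * (t * P t + (1 - t) * Q t)).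
Proof.
move=> [mP _] [mQ _].
apply: measurable_funM; first exact: measurable_funTS.
apply: measurable_funD; first exact: measurable_funM.
by apply: measurable_funM => //; exact: measurable_funB.
Qed.

Lemma objective_itv P Q t : rule P -> rule Q -> t \in `[a, b] ->
  0 <= f t * (t * P t + (1 - t) * Q t) <= f (1 / 2).
Proof.
move=> [_ rP] [_ rQ] tI; have /andP[t0 t1] := itv01 tI.
have /andP[P0 P1] := rP t tI; have /andP[Q0 Q1] := rQ t tI.
have t1' : 0 <= 1 - t by lra.
rewrite mulr_ge0 ?addr_ge0 ?mulr_ge0//= -[leRHS]mulr1 ler_pM//.
- by rewrite addr_ge0// mulr_ge0.
- exact: f_le_half.
- have := ler_wpM2l t0 P1; have := ler_wpM2l t1' Q1; lra.
Qed.

Lemma integrable_objective P Q : rule P -> rule Q ->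
  mu.-integrable `[a, b]
    (EFin \o (fun t => f t * (t * P t + (1 - t) * Q t))).
Proof.
move=> rP rQ; apply: (@integrable_itv _ _ (f (1 / 2))).
  exact: measurable_objective.
by move=> t tI; have /andP[x0 x1] := objective_itv rP rQ tI; rewrite ger0_norm.
Qed.

Lemma incentive_integral P Q x y : rule P -> rule Q -> incentive P Q ->
  a <= x -> x <= y -> y <= b ->
  \int[mu]_(t in `[x, y]) (P t + Q t) = payoff P Q y - payoff P Q x.
Proof.
move=> rP rQ icPQ; apply: (@subgradient_integral _ _ _ a b x y 2).
- by apply: measurable_funD; [exact: (proj1 rP)|exact: (proj1 rQ)].
- move=> t tI; rewrite (le_trans (ler_normD _ _))//.
  have := rule_norm rP tI; have := rule_norm rQ tI; lra.
- by move=> s t sI tI; have := icPQ t s tI sI; rewrite /payoff; lra.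
Qed.

Lemma h_incr s t : a <= s -> s <= t -> t <= 1 / 2 -> h s <= h t.
Proof.
move=> as_ st t2; rewrite /h.
have s0 := le_trans a0 as_.
apply: ler_pM => //; last exact: f_incr.
  by rewrite !mulr_ge0//; lra.
(* This product equals t (1 - t) - s (1 - s). *)
have : 0 <= (t - s) * (1 - t - s) by rewrite mulr_ge0//; lra.
lra.
Qed.

Lemma h_decr s t : 1 / 2 <= s -> s <= t -> t <= b -> h t <= h s.
Proof.
move=> s2 st tb; rewrite /h.
apply: ler_pM => //; last exact: f_decr.
  by rewrite !mulr_ge0//; have := b1; lra.
have : 0 <= (t - s) * (t + s - 1) by rewrite mulr_ge0//; lra.
lra.
Qed.

Lemma h_ge0 t : t \in `[a, b] -> 0 <= h t.
Proof. by move=> /itv01/andP[t0 t1]; rewrite /h !mulr_ge0//; lra. Qed.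

(* With U = payoff P Q one has
   t P + (1 - t) Q = (2 t - 1) U + 2 t (1 - t) (P + Q), where P + Q is a
   subgradient of U; this is where the weight h comes from. *)
Lemma single_crossing P1 Q1 P2 Q2 :
  rule P1 -> rule Q1 -> rule P2 -> rule Q2 ->
  incentive P1 Q1 -> incentive P2 Q2 ->
  (forall t, a <= t -> t <= 1 / 2 -> payoff P2 Q2 t <= payoff P1 Q1 t) ->
  (forall t, 1 / 2 <= t -> t <= b -> payoff P1 Q1 t <= payoff P2 Q2 t) ->
  objective P1 Q1 <= objective P2 Q2.
Proof.
move=> rP1 rQ1 rP2 rQ2 ic1 ic2 left right.
pose D t := payoff P2 Q2 t - payoff P1 Q1 t.
pose e t := (P2 t + Q2 t) - (P1 t + Q1 t).
have a2 : a <= 1 / 2 by have := ab; have := abE; lra.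
have b2 : 1 / 2 <= b by have := ab; have := abE; lra.
have D2 : D (1 / 2) = 0.
  apply/eqP; rewrite /D subr_eq0 eq_le; apply/andP; split.
    exact: left.
  exact: right.
have mh : measurable_fun setT h.
  apply: measurable_funM => //; apply: measurable_funM; first exact: measurable_funM.
  exact: measurable_funB.
have me : measurable_fun `[a, b] e.
  by apply: measurable_funB; apply: measurable_funD;
    [exact: (proj1 rP2)|exact: (proj1 rQ2)|exact: (proj1 rP1)|exact: (proj1 rQ1)].
have be t : t \in `[a, b] -> `|e t| <= 2.
  move=> tI; have /andP[? ?] := proj2 rP1 t tI; have /andP[? ?] := proj2 rP2 t tI.
  have /andP[? ?] := proj2 rQ1 t tI; have /andP[? ?] := proj2 rQ2 t tI.
  by rewrite /e ler_norml; apply/andP; split; lra.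
have bh t : t \in `[a, b] -> `|h t| <= h (1 / 2).
  move=> tI; rewrite ger0_norm ?h_ge0//; move: tI; rewrite in_itv /= => /andP[at_ tb].
  have [t2|/ltW t2] := leP t (1 / 2); first exact: h_incr.
  exact: h_decr.
have sumint P Q : rule P -> rule Q -> forall x y, a <= x -> y <= b ->
    mu.-integrable `[x, y] (EFin \o (fun t => P t + Q t)).
  move=> rP rQ x y ax yb; have sub := sub_itvcc ax yb.
  apply: (@integrable_itv _ _ 2).
    apply: (measurable_funS _ sub) => //.
    by apply: measurable_funD; [exact: (proj1 rP)|exact: (proj1 rQ)].
  move=> t /sub tI; rewrite (le_trans (ler_normD _ _))//.
  have := rule_norm rP tI; have := rule_norm rQ tI; lra.
have ie x y : a <= x -> x <= y -> y <= b ->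
    \int[mu]_(t in `[x, y]) e t = D y - D x.
  move=> ax xy yb; rewrite /e RintegralB//; [|exact: sumint|exact: sumint].
  by rewrite !incentive_integral// /D; lra.
(* By parts on each half: the boundary terms at 1/2 vanish with D, and the outer ones, - h a D a and
   h b D b, are nonnegative. The function controlling the variation of h is h itself on the left and
   - h on the right. *)
have he0 : 0 <= \int[mu]_(t in `[a, b]) (h t * e t).
  rewrite (Rintegral_split a2 b2); last first.
    apply: (@integrable_itv _ _ (h (1 / 2) * 2)).
      by apply: measurable_funM => //; exact: measurable_funTS.
    by move=> t tI; rewrite normrM ler_pM//; [exact: bh|exact: be].
  have aI : a \in `[a, b] by rewrite in_itv /= lexx ltW.
  have bI : b \in `[a, b] by rewrite in_itv /= lexx ltW.
  have subl : `[a, 1 / 2] `<=` `[a, b] by exact: sub_itvcc.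
  have subr : `[1 / 2, b] `<=` `[a, b] by exact: sub_itvcc.
  apply: addr_ge0.
    apply: le_trans (@by_parts_ge _ h e D h a (1 / 2) 2 (h (1 / 2)) a2 _ _ _ _ _ _ _).
    + rewrite D2 mulr0 sub0r oppr_ge0 mulr_ge0_le0 ?h_ge0//.
      by rewrite /D subr_le0; exact: left.
    + exact: measurable_funTS.
    + exact: (measurable_funS _ subl).
    + by move=> t /subl; exact: bh.
    + by move=> t /subl; exact: be.
    + by move=> x y ax xy y2; apply: ie => //; lra.
    + move=> x t y ax xt ty y2.
      have h1 := h_incr ax xt (le_trans ty y2).
      have h2 := h_incr (le_trans ax xt) ty y2.
      by rewrite ler_norml; apply/andP; split; lra.
    + move=> x y ax xy y2; apply: mulr_ge0_le0.
        by rewrite subr_ge0; exact: h_incr.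
      by rewrite /D subr_le0; apply: left => //; lra.
  apply: le_trans (@by_parts_ge _ h e D (fun t => - h t) (1 / 2) b 2 (h (1 / 2)) b2 _ _ _ _ _ _ _).
  + rewrite D2 mulr0 subr0 mulr_ge0 ?h_ge0//.
    by rewrite /D subr_ge0; exact: right.
  + exact: measurable_funTS.
  + exact: (measurable_funS _ subr).
  + by move=> t /subr; exact: bh.
  + by move=> t /subr; exact: be.
  + by move=> x y x2 xy yb; apply: ie => //; lra.
  + move=> x t y x2 xt ty yb.
    have h1 := h_decr x2 xt (le_trans ty yb).
    have h2 := h_decr (le_trans x2 xt) ty yb.
    by rewrite ler_norml; apply/andP; split; lra.
  + move=> x y x2 xy yb; apply: mulr_le0_ge0.
      by rewrite subr_le0; exact: h_decr.
    by rewrite /D subr_ge0; apply: right => //; lra.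
have ihe : mu.-integrable `[a, b] (EFin \o (fun t => h t * e t)).
  apply: (@integrable_itv _ _ (h (1 / 2) * 2)).
    by apply: measurable_funM => //; exact: measurable_funTS.
  by move=> t tI; rewrite normrM ler_pM//; [exact: bh|exact: be].
(* The rest of the difference of objectives has integrand f t (2 t - 1) D t, nonnegative because D
   changes sign at 1/2 together with 2 t - 1. *)
apply: (@le_trans _ _ (objective P1 Q1 + \int[mu]_(t in `[a, b]) (h t * e t))).
  by rewrite lerDl.
rewrite /objective -RintegralD//; last exact: integrable_objective.
apply: le_Rintegral => //.
- by apply: (integrableD _ (integrable_objective rP1 rQ1) ihe).
- exact: integrable_objective.
move=> t; rewrite /= in_itv /= => /andP[at_ tb].
have : 0 <= f t * ((2 * t - 1) * D t).
  apply: mulr_ge0 => //; have [t2|/ltW t2] := leP t (1 / 2).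
    by apply: mulr_le0; [lra|rewrite /D subr_le0; exact: left].
  by apply: mulr_ge0; [lra|rewrite /D subr_ge0; exact: right].
rewrite /h /e /D /payoff; lra.
Qed.


(** * Menus of likelihood-ratio tests, with p and q standing for the tails in the two states *)

Variables p q : R -> R.
Hypotheses (p_cont : continuous p) (q_cont : continuous q)
  (p01 : forall t, 0 <= p t <= 1) (q01 : forall t, 0 <= q t <= 1)
  (p_noninc : {homo p : s t / s <= t >-> t <= s})
  (q_noninc : {homo q : s t / s <= t >-> t <= s})
  (p0 : p 0 = 1) (q0 : q 0 = 1)
  (pq_ge0 : forall t, 0 <= t -> 0 <= p t - t * q t)
  (pq_opt : forall s t, 0 <= t -> p s - t * q s <= p t - t * q t).

(** The zero of the line t |-> t p tau - (1 - t) q tau; for the actual tails it is [s_min]. *)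
Definition cutoff (tau : R) : R := q tau / (p tau + q tau).

(** The interim form of [x_star], with [phi] equal to [p] or [q]. The threshold (1 - t) / t arises
    because LR(s_i, s_{-i}) >= 1 means LR(s_{-i}) >= (1 - t) / t when s_i = t. *)
Definition menu (phi : R -> R) (tau t : R) : R :=
  if t <= cutoff tau then 0
  else if t <= s_max tau then phi tau else phi ((1 - t) / t).

Lemma cutoff_ge0 tau : 0 <= cutoff tau.
Proof.
have /andP[x0 _] := p01 tau; have /andP[y0 _] := q01 tau.
by rewrite /cutoff divr_ge0// addr_ge0.
Qed.

(* When p tau = q tau = 0 the cutoff is 0 / 0 = 0, which is harmless. *)
Lemma cutoffP tau t :
  if t <= cutoff tau then t * p tau - (1 - t) * q tau <= 0
  else 0 <= t * p tau - (1 - t) * q tau.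
Proof.
have /andP[x0 _] := p01 tau; have /andP[y0 _] := q01 tau.
have -> : t * p tau - (1 - t) * q tau = t * (p tau + q tau) - q tau by ring.
have [s0|s0] := leP (p tau + q tau) 0.
  have -> : p tau + q tau = 0 by apply/eqP; rewrite eq_le s0 addr_ge0.
  have -> : q tau = 0 by apply/eqP; rewrite eq_le y0 andbT; lra.
  by rewrite mulr0 subr0 lexx if_same.
rewrite /cutoff ler_pdivlMr//; case: leP => [|/ltW] hle.
  by rewrite subr_le0.
by rewrite subr_ge0.
Qed.

(** Comparison with threshold 0 gives p tau - tau q tau >= 1 - tau, that is p tau - q tau >= (1 -
    tau) (1 - q tau) >= 0. *)
Lemma cutoff_le_half tau : 0 <= tau <= 1 -> cutoff tau <= 1 / 2.
Proof.
move=> /andP[tau0 tau1].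
have /andP[x0 _] := p01 tau; have /andP[y0 y1] := q01 tau.
have qp : q tau <= p tau.
  have := pq_opt 0 tau0; rewrite p0 q0.
  have : 0 <= (1 - tau) * (1 - q tau) by rewrite mulr_ge0//; lra.
  lra.
have [s0|s0] := leP (p tau + q tau) 0.
  rewrite /cutoff (_ : p tau + q tau = 0) ?invr0 ?mulr0; first by lra.
  by apply/eqP; rewrite eq_le s0 addr_ge0.
rewrite /cutoff ler_pdivrMr//; lra.
Qed.

Lemma s_maxP (tau t : R) : 0 <= tau -> (t <= s_max tau) = (t * tau <= 1 - t).
Proof.
move=> tau0; rewrite /s_max ler_pdivlMr; last lra.
by rewrite mulrDr mulr1 lerBrDl.
Qed.

Lemma s_max_ge_half (tau : R) : 0 <= tau <= 1 -> 1 / 2 <= s_max tau.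
Proof. by move=> /andP[tau0 tau1]; rewrite s_maxP//; lra. Qed.

Lemma odds_lt (tau t : R) : 0 <= tau -> 0 < t -> s_max tau < t -> (1 - t) / t < tau.
Proof.
move=> tau0 t0; rewrite ltNge s_maxP// -ltNge => tt.
by rewrite ltr_pdivrMr// mulrC.
Qed.

(** The threshold in force falls with the report: infinite up to the cutoff, then tau, then (1 - t)
    / t < tau. Monotonicity yields the measurability of the menu. *)
Lemma menu_nondecreasing (phi : R -> R) tau : 0 <= tau ->
  (forall s, 0 <= phi s) -> {homo phi : s t / s <= t >-> t <= s} ->
  {homo menu phi tau : s t / s <= t}.
Proof.
move=> tau0 phi0 phid s t st; rewrite /menu.
have c0 := cutoff_ge0 tau.
case: (leP s (cutoff tau)) => sc.
  by case: ifP => // _; case: ifP.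
have s0 : 0 < s by exact: le_lt_trans c0 sc.
have t0 : 0 < t by exact: lt_le_trans s0 st.
rewrite [t <= _]leNgt (lt_le_trans sc st) /=.
have [sm|sm] := leP s (s_max tau).
  have [//|tm] := leP t (s_max tau).
  by apply: phid; rewrite ltW// odds_lt.
rewrite [t <= _]leNgt (lt_le_trans sm st) /=; apply: phid.
rewrite ler_pdivrMr// mulrAC ler_pdivlMr//; lra.
Qed.

Lemma menu_rule (phi : R -> R) tau : 0 <= tau ->
  (forall s, 0 <= phi s <= 1) -> {homo phi : s t / s <= t >-> t <= s} ->
  rule (menu phi tau).
Proof.
move=> tau0 phi01 phid; split.
  apply: nondecreasing_measurable; first exact: measurable_itv.
  by apply: menu_nondecreasing => // s; case/andP: (phi01 s).
by move=> t _; rewrite /menu; case: ifP => _; [rewrite lexx ler01|case: ifP].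
Qed.

(** Divided by t, the payoff of type t is P - tau Q at tau = (1 - t) / t, so the test with that
    threshold is first-best for her. *)
Lemma payoff_le_odds P Q t : 0 < t -> t <= 1 ->
  (forall tau, 0 <= tau -> P - tau * Q <= p tau - tau * q tau) ->
  t * P - (1 - t) * Q <= t * p ((1 - t) / t) - (1 - t) * q ((1 - t) / t).
Proof.
move=> t0 t1 PQ; have o0 : 0 <= (1 - t) / t by rewrite divr_ge0 ?subr_ge0 ?(ltW t0).
have := ler_wpM2l (ltW t0) (PQ _ o0); rewrite !mulrBr !mulrA.
by rewrite [t * (1 - t)]mulrC mulfK ?gt_eqF.
Qed.

Lemma payoff_menuE tau t : payoff (menu p tau) (menu q tau) t =
  if t <= cutoff tau then 0
  else if t <= s_max tau then t * p tau - (1 - t) * q tau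
  else t * p ((1 - t) / t) - (1 - t) * q ((1 - t) / t).
Proof.
by rewrite /payoff /menu; case: ifP => _; [rewrite !mulr0 subr0|case: ifP].
Qed.

Lemma payoff_menu_ge tau t : 0 <= tau -> 0 <= t <= 1 ->
  0 <= payoff (menu p tau) (menu q tau) t /\
  t * p tau - (1 - t) * q tau <= payoff (menu p tau) (menu q tau) t.
Proof.
move=> tau0 /andP[t0 t1]; rewrite payoff_menuE; have := cutoffP tau t.
case: leP => [//|tc c0]; case: (leP t (s_max tau)) => [//|_].
have t0' : 0 < t by exact: le_lt_trans (cutoff_ge0 tau) tc.
suff le1 : t * p tau - (1 - t) * q tau <=
    t * p ((1 - t) / t) - (1 - t) * q ((1 - t) / t).
  by split => //; exact: le_trans c0 le1.
by apply: payoff_le_odds => // s s0; exact: pq_opt.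
Qed.

Lemma menu_incentive tau : 0 <= tau <= 1 -> incentive (menu p tau) (menu q tau).
Proof.
move=> tau01 t r tI rI; have /andP[tau0 _] := tau01.
have /andP[t0 t1] := itv01 tI; have /andP[r0 r1] := itv01 rI.
have [V0 Vt] := payoff_menu_ge tau0 (itv01 tI).
have -> : t * menu p tau r - (1 - t) * menu q tau r =
    if r <= cutoff tau then 0
    else if r <= s_max tau then t * p tau - (1 - t) * q tau
    else t * p ((1 - r) / r) - (1 - t) * q ((1 - r) / r).
  by rewrite /menu; case: ifP => _; [rewrite !mulr0 subr0|case: ifP].
have [//|rc] := leP r (cutoff tau).
have [//|rm] := leP r (s_max tau).
have {}r0 : 0 < r by exact: le_lt_trans (cutoff_ge0 tau) rc.
set rho := (1 - r) / r.
have rho0 : 0 <= rho by rewrite divr_ge0 ?subr_ge0 ?(ltW r0).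
have rhot : rho < tau by exact: odds_lt.
have [tm|tm] := leP t (s_max tau).
  (* A type with t tau <= 1 - t loses by lowering the threshold from tau to rho: optimality at tau
     bounds the gain t (p rho - p tau) by t tau (q rho - q tau), at most the loss (1 - t) (q rho - q
     tau). *)
  apply: le_trans Vt.
  have h1 := pq_opt rho tau0; have h2 := pq_opt tau rho0.
  have dq : 0 <= q rho - q tau.
    rewrite -(pmulr_rge0 _ (_ : 0 < tau - rho)) ?subr_gt0//; lra.
  move: tm; rewrite s_maxP// => tm.
  have h3 := ler_wpM2r dq tm.
  have : t * (p rho - p tau) <= t * (tau * (q rho - q tau)).
    by apply: ler_wpM2l => //; lra.
  lra.
have tc : cutoff tau < t.
  by rewrite (le_lt_trans (cutoff_le_half tau01))// (le_lt_trans (s_max_ge_half tau01)).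
rewrite payoff_menuE ![t <= _]leNgt tc tm /=.
apply: payoff_le_odds => //; first exact: le_lt_trans (cutoff_ge0 tau) tc.
by move=> s s0; exact: pq_opt.
Qed.

(** Left of 1/2, U dominates 0 by participation and the payoff from reporting 1/2; that line meets
    the support line at 1/2 and is the less steep one. Right of 1/2, the pair (P t, Q t) is bounded
    by the incentive constraint of type 1/2 and by Neyman-Pearson at tau, up to [s_max], and by the
    first best beyond. *)
Lemma objective_le_menu P Q tau : rule P -> rule Q -> incentive P Q ->
  (forall t, t \in `[a, b] -> 0 <= payoff P Q t) ->
  (forall t s, t \in `[a, b] -> 0 <= s -> P t - s * Q t <= p s - s * q s) ->
  0 <= tau < 1 -> p tau - q tau = P (1 / 2) - Q (1 / 2) ->
  objective P Q <= objective (menu p tau) (menu q tau).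
Proof.
move=> rP rQ icPQ pPQ optPQ /andP[tau0 tau1] e.
have tau01 : 0 <= tau <= 1 by rewrite tau0 ltW.
have hI : 1 / 2 \in `[a, b].
  by have := ab; have := abE; rewrite in_itv /= => ? ?; apply/andP; split; lra.
apply: single_crossing => //; try exact: menu_rule; first exact: menu_incentive.
- move=> t at_ t2.
  have tI : t \in `[a, b].
    by have := ab; have := abE; rewrite in_itv /= at_ /= => ? ?; lra.
  rewrite payoff_menuE; case: ifP => _; first exact: pPQ.
  rewrite (le_trans t2 (s_max_ge_half tau01)).
  apply: le_trans (icPQ t _ tI hI).
  have := optPQ _ tau hI tau0; set P1 := P _; set Q1 := Q _ => h1.
  (* The Neyman-Pearson bound at tau and the equal values of the difference at 1/2 give this only
     after multiplication by 1 - tau, hence tau < 1. *)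
  have dq : 0 <= q tau - Q1.
    rewrite -(pmulr_rge0 _ (_ : 0 < 1 - tau)) ?subr_gt0//.
    by move: e; rewrite -/P1 -/Q1 => e; lra.
  have e' : P1 = p tau - (q tau - Q1) by move: e; rewrite -/P1 -/Q1; lra.
  have : 0 <= (q tau - Q1) * (1 - 2 * t) by rewrite mulr_ge0//; lra.
  by rewrite e'; lra.
- move=> t t2 tb.
  have tI : t \in `[a, b].
    by have := ab; have := abE; rewrite in_itv /= tb andbT => ? ?; lra.
  have /andP[t0 t1] := itv01 tI.
  have ic1 := icPQ (1 / 2) t hI tI; rewrite /payoff in ic1 *.
  rewrite -[leRHS]/(payoff (menu p tau) (menu q tau) t) payoff_menuE.
  have ic2 : P t - Q t <= p tau - q tau by rewrite e; lra.
  case: (leP t (cutoff tau)) => tc.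
    have t2E : t = 1 / 2.
      by apply/eqP; rewrite eq_le t2 andbT (le_trans tc)// cutoff_le_half.
    by have := cutoffP tau t; rewrite tc t2E => ?; rewrite -t2E; move: ic2; rewrite t2E; lra.
  case: (leP t (s_max tau)) => tm; last first.
    apply: payoff_le_odds => //; first exact: le_lt_trans (cutoff_ge0 tau) tc.
    by move=> s s0; exact: optPQ.
  move: tm; rewrite s_maxP// => tm.
  (* The identity used is (1 - tau) (t P - (1 - t) Q) = (1 - t - t tau) (P - Q) + (2 t - 1) (P - tau
     Q); both weights are nonnegative for 1/2 <= t <= [s_max tau]. *)
  have h2 := optPQ t tau tI tau0.
  rewrite -(ler_pM2l (_ : 0 < 1 - tau)) ?subr_gt0//.
  have w1 : 0 <= 1 - t - t * tau by lra.
  have w2 : 0 <= 2 * t - 1 by lra.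
  have := ler_wpM2l w1 ic2; have := ler_wpM2l w2 h2; lra.
Qed.


(** Off the two jump points the branch taken at t is eventually constant, except when p tau + q tau
    = 0; the bound of [phi] by p + q is there for that case. *)
Lemma cvg_menu (phi : R -> R) (u : nat -> R) (tau t : R) : continuous phi ->
  (forall s, 0 <= phi s <= p s + q s) ->
  (forall k, 0 <= u k <= 1) -> 0 <= tau <= 1 ->
  u k @[k --> \oo] --> tau -> t != cutoff tau -> t != s_max tau ->
  menu phi (u k) t @[k --> \oo] --> menu phi tau t.
Proof.
move=> cphi phi0 u01 tau01 utau tc tm.
have /andP[tau0 _] := tau01.
have cvgc g : continuous g -> g (u k) @[k --> \oo] --> (g tau : R).
  by move=> cg; apply: cvg_comp utau _; exact: cg.
have u0 k : 0 <= u k by case/andP: (u01 k).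
have tu : (t * (1 + u k)) @[k --> \oo] --> t * (1 + tau).
  by apply: cvgM; [exact: cvg_cst|apply: cvgD => //; exact: cvg_cst].
have s_maxE (s : R) : 0 <= s -> (t <= s_max s) = (t * (1 + s) <= 1).
  by move=> s0; rewrite s_maxP// mulrDr mulr1 lerBrDl.
have [tm'|tm'] := ltP (s_max tau) t.
  have ct : cutoff tau < t.
    by rewrite (le_lt_trans (cutoff_le_half tau01))// (le_lt_trans (s_max_ge_half tau01)).
  rewrite [X in _ --> X](_ : _ = phi ((1 - t) / t)); last first.
    by rewrite /menu ![t <= _]leNgt ct tm'.
  apply: cvg_near_cst; near=> k.
  have t2 : 1 / 2 < t by exact: le_lt_trans (s_max_ge_half tau01) tm'.
  rewrite /menu s_maxE// ifF; last first.
    by apply/negbTE; rewrite -ltNge (le_lt_trans (cutoff_le_half (u01 k))).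
  rewrite ifF//; apply/negbTE; rewrite -ltNge; near: k; apply: cvgr_gt tu _ _.
  by rewrite ltNge -s_maxE// -ltNge.
have {tm}tm' : t < s_max tau by rewrite lt_neqAle tm.
have near_s : \forall k \near \oo, t <= s_max (u k).
  near=> k; rewrite s_maxE//; apply/ltW; near: k; apply: cvgr_lt tu _ _.
  rewrite lt_neqAle -s_maxE// (ltW tm') andbT.
  apply: contraTneq tm' => e; rewrite -leNgt /s_max ler_pdivrMr ?e//.
  by lra.
(* Here the cutoff is 0 / 0 and may be discontinuous, but [phi] vanishes at tau as well, so
   whichever branch is taken the menu is squeezed to 0. *)
have [pq0|pq0] := eqVneq (p tau + q tau) 0.
  have phitau : phi tau = 0.
    by apply/eqP; rewrite eq_le andbC; have := phi0 tau; rewrite pq0.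
  rewrite [X in _ --> X](_ : _ = 0); last first.
    by rewrite /menu (ltW tm') phitau; case: ifP.
  have phiu : phi (u k) @[k --> \oo] --> 0 by rewrite -phitau; exact: cvgc.
  apply: squeeze_cvgr (cvg_cst 0) phiu.
  near=> k; have /andP[phi_ge0 _] := phi0 (u k).
  rewrite /menu (_ : t <= s_max (u k)); last by near: k.
  by case: ifP => _; rewrite ?lexx ?phi_ge0.
have cutu : cutoff (u k) @[k --> \oo] --> cutoff tau.
  apply: cvgM; first exact: cvgc.
  by apply: cvgV => //; apply: cvgD; exact: cvgc.
have [tc'|tc'] := ltP t (cutoff tau).
  rewrite [X in _ --> X](_ : _ = 0); last by rewrite /menu (ltW tc').
  apply: cvg_near_cst; near=> k; rewrite /menu ifT//.
  by apply/ltW; near: k; apply: cvgr_gt cutu _ _.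
have {tc}tc' : cutoff tau < t by rewrite lt_neqAle eq_sym tc.
rewrite [X in _ --> X](_ : _ = phi tau); last first.
  by rewrite /menu [t <= cutoff _]leNgt tc' (ltW tm').
apply: cvg_trans (cvgc phi cphi); apply: near_eq_cvg.
near=> k; rewrite /menu ifF; last first.
  by apply/negbTE; rewrite -ltNge; near: k; apply: cvgr_lt cutu _ _.
by rewrite ifT//; near: k.
Unshelve. all: by end_near. Qed.

Lemma cvg_objective_menu (u : nat -> R) (tau : R) :
  (forall k, 0 <= u k <= 1) -> 0 <= tau <= 1 -> u k @[k --> \oo] --> tau ->
  objective (menu p (u k)) (menu q (u k)) @[k --> \oo] -->
  objective (menu p tau) (menu q tau).
Proof.
move=> u01 tau01 utau.
have rp s : 0 <= s <= 1 -> rule (menu p s).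
  by move=> /andP[s0 _]; exact: menu_rule.
have rq s : 0 <= s <= 1 -> rule (menu q s).
  by move=> /andP[s0 _]; exact: menu_rule.
pose F s t : R := f t * (t * menu p s t + (1 - t) * menu q s t).
have mF s : 0 <= s <= 1 -> measurable_fun `[a, b] (EFin \o F s).
  by move=> s01; apply/measurable_EFinP; apply: measurable_objective; [exact: rp|exact: rq].
have ae_cv : {ae mu, forall t, `[a, b]%classic t ->
    (EFin \o F (u k)) t @[k --> \oo] --> (EFin \o F tau) t}.
  exists [set cutoff tau; s_max tau]; split.
  - by apply: measurableU; exact: measurable_set1.
  - by apply: countable_lebesgue_measure0; apply: finite_set_countable.
  - move=> t /= /not_implyP[tI ncv]; apply: contrapT => tN; apply: ncv.
    have tc : t != cutoff tau by apply/eqP => e; apply: tN; left.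
    have tm : t != s_max tau by apply/eqP => e; apply: tN; right.
    apply/cvg_EFin; first exact: nearW.
    apply: cvgM; first exact: cvg_cst.
    apply: cvgD; (apply: cvgM; first exact: cvg_cst);
      apply: cvg_menu => // s.
      by have /andP[x0 x1] := p01 s; have /andP[y0 y1] := q01 s; rewrite x0 lerDl.
    by have /andP[x0 x1] := p01 s; have /andP[y0 y1] := q01 s; rewrite y0 lerDr.
have ig : mu.-integrable `[a, b] (EFin \o cst (f (1 / 2))).
  by apply: (@integrable_itv _ _ `|f (1 / 2)|) => //; exact: measurable_cst.
have ae_le : {ae mu, forall t k, `[a, b]%classic t ->
    (`|(EFin \o F (u k)) t| <= (EFin \o cst (f (1 / 2))) t)%E}.
  apply: aeW => t k tI; rewrite lee_fin.
  have /andP[F0 F1] := objective_itv (rp _ (u01 k)) (rq _ (u01 k)) tI.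
  by rewrite ger0_norm.
have mab : measurable (`[a, b]%classic : set (measurableTypeR R)) by exact: measurable_itv.
have [_ _ cv] := dominated_convergence (mu := mu) mab
  (fun k => mF _ (u01 k)) (mF _ tau01) ae_cv ig ae_le.
apply: fine_cvg; rewrite fineK; first exact: cv.
apply: integrable_fin_num => //.
exact: integrable_objective (rp _ tau01) (rq _ tau01).
Qed.

Lemma optimal_menu : exists2 tau, 0 <= tau <= 1 &
  forall P Q, rule P -> rule Q -> incentive P Q ->
  (forall t, t \in `[a, b] -> 0 <= payoff P Q t) ->
  (forall t s, t \in `[a, b] -> 0 <= s -> P t - s * Q t <= p s - s * q s) ->
  objective P Q <= objective (menu p tau) (menu q tau).
Proof.
pose J s := objective (menu p s) (menu q s).
(* The projection of the line onto [0, 1], which makes the objective a continuous function on all of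
   R. *)
pose clamp (s : R) := (1 + `|s| - `|s - 1|) / 2.
have clampE s : 0 <= s <= 1 -> clamp s = s.
  by move=> /andP[s0 s1]; rewrite /clamp ger0_norm// ler0_norm; [field|lra].
have clamp01 s : 0 <= clamp s <= 1.
  rewrite /clamp; apply/andP.
  by case: (ger0P s) => ?; case: (ger0P (s - 1)) => ?; split; lra.
have cJ : continuous (J \o clamp).
  move=> s; apply/(@cvg_nbhsP _ R^o) => u us; apply: cvg_objective_menu => //.
  apply: cvgM; last exact: cvg_cst.
  apply: cvgB; last by apply: cvg_norm; apply: cvgB => //; exact: cvg_cst.
  by apply: cvgD; [exact: cvg_cst|exact: cvg_norm].
have [tau tauI tauM] := EVT_max ler01 (continuous_subspaceT cJ).
have tau01 : 0 <= tau <= 1 by move: tauI; rewrite in_itv.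
exists tau => // P Q rP rQ icPQ pPQ optPQ.
have hI : 1 / 2 \in `[a, b].
  by have := ab; have := abE; rewrite in_itv /= => ? ?; apply/andP; split; lra.
have Jmax s : 0 <= s <= 1 -> J s <= J tau.
  by move=> s01; have := tauM s; rewrite in_itv /= !clampE//; exact.
(* Twice the value at 1/2 of the support line with parameter s. *)
pose d (s : R) := p s - q s.
have cd : continuous d by move=> s; apply: cvgB; [exact: p_cont|exact: q_cont].
have d0 : d 0 = 0 by rewrite /d p0 q0 subrr.
have d1 : 0 <= d 1 by have := pq_opt 0 (ler01); rewrite p0 q0 /d; lra.
have step P' Q' : rule P' -> rule Q' -> incentive P' Q' ->
    (forall t, t \in `[a, b] -> 0 <= payoff P' Q' t) ->
    (forall t s, t \in `[a, b] -> 0 <= s -> P' t - s * Q' t <= p s - s * q s) ->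
    P' (1 / 2) - Q' (1 / 2) < d 1 -> objective P' Q' <= J tau.
  move=> rP' rQ' ic' pay' opt' lt1.
  have ge0 : 0 <= P' (1 / 2) - Q' (1 / 2) by have := pay' _ hI; rewrite /payoff; lra.
  have [|s sI sE] := @IVT R d 0 1 (P' (1 / 2) - Q' (1 / 2)) ler01 (continuous_subspaceT cd).
    by rewrite d0 min_l// max_r// ge0 ltW.
  move: sI; rewrite in_itv /= => s01; apply: le_trans (Jmax s s01).
  apply: objective_le_menu => //; have /andP[-> s1] := s01.
  rewrite lt_neqAle s1 andbT; apply/eqP => e.
  by move: lt1; rewrite -sE e ltxx.
have le1 : P (1 / 2) - Q (1 / 2) <= d 1.
  by have := optPQ _ 1 hI ler01; rewrite /d !mul1r.
have [lt1|ge1] := ltP (P (1 / 2) - Q (1 / 2)) (d 1); first exact: step.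
(* If d 1 = 0 then 0 is the only possible value at 1/2, and parameter 0 already attains it. *)
have [d1z|d1p] := leP (d 1) 0.
  apply: le_trans (Jmax 0 _); last by rewrite lexx ler01.
  apply: objective_le_menu; rewrite ?lexx ?ltr01//.
  by rewrite -/(d 0) d0; apply/eqP; rewrite eq_le; apply/andP; split; lra.
(* The payoff at 1/2 is the largest possible one: apply the strict case to the
   scaled rules (1 - e) P and (1 - e) Q, and let e tend to 0. *)
have scale e : 0 < e -> e <= 1 -> (1 - e) * objective P Q <= J tau.
  move=> e0 e1.
  have e1' : 0 <= 1 - e by rewrite subr_ge0.
  have rs P' : rule P' -> rule (fun t => (1 - e) * P' t).
    move=> [mP' P'01]; split; first exact: measurable_funM.
    move=> t tI; have /andP[? ?] := P'01 t tI.
    by rewrite mulr_ge0//= mulr_ile1//; lra.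
  have payS t x y : t * ((1 - e) * x) - (1 - t) * ((1 - e) * y) =
    (1 - e) * (t * x - (1 - t) * y) by ring.
  have -> : (1 - e) * objective P Q =
      objective (fun t => (1 - e) * P t) (fun t => (1 - e) * Q t).
    rewrite /objective -RintegralZl//; last exact: integrable_objective.
    by apply: eq_Rintegral => t _; ring.
  apply: step; [exact: rs|exact: rs| | | |].
  - by move=> t r tI rI; rewrite /payoff !payS ler_wpM2l//; exact: icPQ.
  - by move=> t tI; rewrite /payoff payS mulr_ge0//; exact: pPQ.
  (* Scaling preserves the bounds because p s - s q s >= 0. *)
  - move=> t s tI s0; have h1 := ler_wpM2l e1' (optPQ t s tI s0).
    have h3 := mulr_ge0 (ltW e0) (pq_ge0 s0); lra.
  - rewrite -mulrBr; have := ler_wpM2l e1' le1; have := mulr_gt0 e0 d1p; lra.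
apply/ler_addgt0Pr => e e0.
have obj0 : 0 <= objective P Q.
  by apply: Rintegral_ge0 => t tI; case/andP: (objective_itv rP rQ tI).
have oe : 0 < objective P Q + e by lra.
(* With this scale the lost part of the objective is at most e. *)
have e'0 : 0 < e / (objective P Q + e) by rewrite divr_gt0.
have e'1 : e / (objective P Q + e) <= 1 by rewrite ler_pdivrMr//; lra.
have := scale _ e'0 e'1; rewrite mulrBl mul1r lerBlDr => /le_trans; apply.
by rewrite lerD2l mulrAC ler_pdivrMr// ler_pM2l//; lra.
Qed.

End Screening.

(** * From mechanisms to interim rules, and the interim form of [x_star] *)

Section Mechanisms.
Context {R : realType} {n : nat}.
Set Implicit Arguments. Unset Strict Implicit.
Notation mu := (@lebesgue_measure R).
Implicit Types (v w : 'I_n -> R) (phi : ('I_n -> R) -> R).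

Lemma iint_upd_base (D : set R) (skip : nat -> bool) m g v v' :
  (forall k : 'I_n, skip k || (m <= k)%N -> v k = v' k) ->
  iint D skip m g v = iint D skip m g v'.
Proof.
elim: m v v' => [|m ih] v v' vv' /=.
  by congr g; apply/funext => k; rewrite vv'// orbT.
case: ifP => sm.
  apply: ih => k /orP[sk|]; first by rewrite vv' ?sk.
  rewrite leq_eqVlt => /predU1P[mk|mk]; last by rewrite vv'// mk orbT.
  by rewrite vv'// -mk sm.
apply: eq_integral => t _; apply: ih => k; rewrite /upd.
case: eqVneq => // km /orP[sk|mk]; first by rewrite vv' ?sk.
by rewrite vv'// ltn_neqAle eq_sym km mk orbT.
Qed.

Lemma prod_allE (h : R -> R) (i : 'I_n) v :
  prod_all h v = h (v i) * prod_others i h v.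
Proof. by rewrite /prod_all (bigD1 i). Qed.

Lemma measurable_profiles (a b : R) : measurable (@profiles R n a b).
Proof.
rewrite (_ : profiles a b = \bigcap_(j in [set: 'I_n])
    ((fun s : n.-tuple R => tnth s j) @^-1` `[a, b])).
  apply: fin_bigcap_measurable => // j _.
  rewrite -[X in measurable X]setTI.
  by apply: measurable_tnth => //; exact: measurable_itv.
by apply/seteqP; split => s /= sI j; [move=> _; exact: sI|exact: sI].
Qed.

Variables (a b : R) (gp gm : R -> R) (i : 'I_n).
Hypotheses (n2 : (2 <= n)%N) (a0 : 0 <= a) (ab : a < b) (b1 : b <= 1).
Hypotheses (gp0 : forall s, 0 <= gp s) (gm0 : forall s, 0 <= gm s)
  (mgp : measurable_fun setT gp) (mgm : measurable_fun setT gm)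
  (gp1 : (\int[mu]_(s in `[a, b]) (gp s)%:E = 1)%E)
  (gm1 : (\int[mu]_(s in `[a, b]) (gm s)%:E = 1)%E).
Let f := dens gp gm.
Hypotheses (f_gt0 : forall s, s \in `[a, b] -> 0 < f s)
  (gpE : forall s, s \in `[a, b] -> gp s = 2 * f s * s)
  (gmE : forall s, s \in `[a, b] -> gm s = 2 * f s * (1 - s)).

Let p := tail a b i gp.
Let q := tail a b i gm.

Lemma prod_gpE v : (forall k : 'I_n, k != i -> a <= v k <= b) ->
  prod_others i gp v = prod_others i (fun s => 2 * f s) v * prod_others i id v.
Proof.
move=> vab; rewrite /prod_others -big_split /=; apply: eq_bigr => k ki.
by rewrite gpE// in_itv /= vab.
Qed.

Lemma prod_gmE v : (forall k : 'I_n, k != i -> a <= v k <= b) ->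
  prod_others i gm v =
  prod_others i (fun s => 2 * f s) v * prod_others i (fun s => 1 - s) v.
Proof.
move=> vab; rewrite /prod_others -big_split /=; apply: eq_bigr => k ki.
by rewrite gmE// in_itv /= vab.
Qed.

(** On the support the densities of the others in the two states are C A and C B with a common
    factor C >= 0, and the indicator of A >= tau B maximizes phi (A - tau B) pointwise. *)
Lemma neyman_pearson r phi tau : 0 <= tau -> mweight phi ->
  fine (wint a b i gp r phi) - tau * fine (wint a b i gm r phi) <=
  p tau - tau * q tau.
Proof.
move=> tau0 mphi.
have mI := mweight_LR (R := R) i tau.
have finp := wint_fin i mgp gp0 gp1 r mphi.
have finm := wint_fin i mgm gm0 gm1 r mphi.
(* Negative terms change sides, so that only integrals of nonnegative functions are compared. *)
suff : (wint a b i gp r phi + tau%:E * (q tau)%:E <=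
        (p tau)%:E + tau%:E * wint a b i gm r phi)%E.
  rewrite -(fineK finp) -(fineK finm) -!EFinM -!EFinD lee_fin; lra.
rewrite /p /q -(tailE i mgp gp0 gp1 r) -(tailE i mgm gm0 gm1 r).
have m1 := nnmfun_mweight i mgp gp0 mphi.
have m2 := nnmfun_mweight i mgm gm0 mphi.
have m3 := nnmfun_mweight i mgp gp0 mI.
have m4 := nnmfun_mweight i mgm gm0 mI.
have mZ g : nnmfun g -> nnmfun (fun w => (tau%:E * g w)%E : \bar R).
  move=> [mg g0]; split; last by move=> w; rewrite mule_ge0.
  by apply: emeasurable_funM => //; exact: measurable_cst.
have mD g g' : nnmfun g -> nnmfun g' -> nnmfun (fun w => (g w + g' w)%E : \bar R).
  move=> [mg g0] [mg' g0']; split; last by move=> w; rewrite adde_ge0.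
  exact: emeasurable_funD.
rewrite /wint /int_others -!iintZ// -!iintD//; try exact: mZ.
apply: le_iint => //; try by apply: mD => //; exact: mZ.
move=> w /reach_others[wab _].
rewrite -!EFinM -!EFinD lee_fin prod_gpE// prod_gmE//.
have [A0 B0] := prod_others_itv a0 b1 wab.
set A := prod_others i id w in A0 *.
set B := prod_others i (fun s => 1 - s) w in B0 *.
set C := prod_others i (fun s => 2 * f s) w.
have C0 : 0 <= C.
  by apply: prodr_ge0 => k ki; rewrite mulr_ge0// ltW// f_gt0// in_itv /= wab.
have /andP[x0 x1] := proj2 mphi w.
rewrite /LR_others_ge -/A -/B; case: (leP (tau * B) A) => h; rewrite /=.
  have := mulr_ge0 C0 (mulr_ge0 (_ : 0 <= A - tau * B) (_ : 0 <= 1 - phi w)).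
  by rewrite !subr_ge0 => /(_ h x1); lra.
have := mulr_ge0 C0 (mulr_ge0 (_ : 0 <= tau * B - A) x0).
by rewrite subr_ge0 => /(_ (ltW h)); lra.
Qed.

Lemma wint0 (h : R -> R) r : measurable_fun setT h -> (forall t, 0 <= h t) ->
  wint a b i h r (fun=> 0) = 0%E.
Proof.
move=> mh h0; rewrite /wint /int_others.
rewrite (@eq_iint _ _ _ _ _ _ (fun w => 0%:E * (prod_others i h w * 1)%:E)%E).
  by rewrite iintZ ?mul0e//; apply: nnmfun_mweight => //; exact: mweight_cst1.
by move=> w _; rewrite mulr0 mul0e.
Qed.

(** A mechanism is measurable and bounded on [profiles] only; extension by 0 makes it a weight on
    all profiles. *)
Definition weight_of (x : n.-tuple R -> R) v : R := (x \_ (profiles a b)) (tup v).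

Lemma mweight_weight_of x : mech_comp a b x -> mweight (weight_of x).
Proof.
move=> [mx x01]; split.
  rewrite (_ : (fun s => _) = x \_ (profiles a b)); last first.
    by apply/funext => s; rewrite /weight_of tup_tnth.
  by apply/(measurable_restrictT x) => //; exact: measurable_profiles.
move=> v; rewrite /weight_of patchE; case: ifPn => [/set_mem/x01//|_].
by rewrite lexx ler01.
Qed.

Lemma weight_ofE x (r : R) v : r \in `[a, b] ->
  reach `[a, b] (fun k => k == val i) n (fun=> r) v -> weight_of x v = x (tup v).
Proof.
move=> rI /reach_others[vab vi]; rewrite /weight_of patchE ifT//.
apply/mem_set => j; rewrite tnth_mktuple.
by have [->|ji] := eqVneq j i; [rewrite vi|rewrite in_itv /= vab].
Qed.

(** The functions P and Q of a mechanism, for [h] equal to [gp] and [gm]. *)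
Definition interim (h : R -> R) (x : n.-tuple R -> R) (r : R) : R :=
  fine (wint a b i h r (weight_of x)).

Lemma interimE (h : R -> R) x (r : R) : measurable_fun setT h -> (forall t, 0 <= h t) ->
  (\int[mu]_(s in `[a, b]) (h s)%:E = 1)%E -> mech_comp a b x ->
  r \in `[a, b] ->
  int_others `[a, b] i r (fun v => (prod_others i h v * x (tup v))%:E) =
  (interim h x r)%:E.
Proof.
move=> mh h0 h1 mx rI; rewrite /interim fineK; last first.
  exact: (wint_fin i mh h0 h1 r (mweight_weight_of mx)).
by apply: eq_iint => w /(weight_ofE x rI) ->.
Qed.


Lemma condE_interim x (t r : R) : mech_comp a b x -> t \in `[a, b] -> r \in `[a, b] ->
  condE a b gp gm i x t r =
  (t * interim gp x r - (1 - t) * interim gm x r)%:E.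
Proof.
move=> mx tI rI; rewrite /condE !interimE// -!EFinM; congr EFin.
have ft := f_gt0 tI; rewrite gpE// gmE// -/f; field.
by rewrite gt_eqF.
Qed.

Lemma interim_rule (h : R -> R) x : measurable_fun setT h -> (forall t, 0 <= h t) ->
  (\int[mu]_(s in `[a, b]) (h s)%:E = 1)%E -> mech_comp a b x ->
  rule a b (interim h x).
Proof.
move=> mh h0 h1 mx; have mw := mweight_weight_of mx; split.
  apply: measurable_funTS; apply: measurableT_comp => //.
  apply: (nnmfun_comp (F := fun r (_ : 'I_n) => r)) => //.
  by apply: nnmfun_iint => //; exact: nnmfun_mweight.
move=> t _; rewrite /interim fine_ge0 ?wint_ge0//= -lee_fin fineK.
  exact: (wint_le1 i mh h0 h1 t mw).
exact: (wint_fin i mh h0 h1 t mw).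
Qed.

Lemma measurable_prod_all (h : R -> R) : measurable_fun setT h ->
  measurable_fun [set: n.-tuple R] (fun s => prod_all h (tnth s)).
Proof.
move=> mh; apply: measurable_prod => k _.
by apply: (measurableT_comp mh); exact: measurable_tnth.
Qed.

Lemma expected_interim x : mech_comp a b x ->
  expected a b gp gm x =
  (\int[mu]_(r in `[a, b])
    (f r * (r * interim gp x r + (1 - r) * interim gm x r))%:E)%E.
Proof.
move=> mx; have mw := mweight_weight_of mx.
pose g w := ((prod_all gp w + prod_all gm w) / 2 * weight_of x w)%:E.
have mg : nnmfun g.
  split; last first.
    move=> w; rewrite lee_fin mulr_ge0 ?(andP (proj2 mw w)).1//.
    by rewrite divr_ge0// addr_ge0// prodr_ge0.
  apply/measurable_EFinP; apply: measurable_funM; last exact: (proj1 mw).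
  apply: measurable_funM => //.
  by apply: measurable_funD; exact: measurable_prod_all.
rewrite /expected /int_all.
rewrite (@eq_iint _ _ _ _ _ _ g); last first.
  move=> w rw; rewrite /g /weight_of patchE ifT//.
  by apply/mem_set => j; rewrite tnth_mktuple; have := rw j; rewrite ltn_ord.
rewrite (@iint_fubini _ _ _ i) //.
apply: eq_integral => r /set_mem rI.
(* Only coordinate i of the base profile survives the integration, so the base can be the constant r
   of [int_others]. *)
rewrite (@iint_upd_base _ _ _ _ _ (fun=> r)); last first.
  move=> k; rewrite [(n <= k)%N]leqNgt ltn_ord orbF => /eqP ki.
  by rewrite /upd; case: eqP => // ne; case: ne; exact: ki.
rewrite (@eq_iint _ _ _ _ _ _ (fun w =>
    (gp r / 2)%:E * (prod_others i gp w * weight_of x w)%:E +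
    (gm r / 2)%:E * (prod_others i gm w * weight_of x w)%:E)%E); last first.
  move=> w /reach_others[wab wi]; rewrite -!EFinM -EFinD; congr EFin.
  by rewrite !(prod_allE _ i) wi; field.
have mZ (h : R -> R) (c : R) : measurable_fun setT h -> (forall t, 0 <= h t) ->
    0 <= c -> nnmfun (fun w => (c%:E * (prod_others i h w * weight_of x w)%:E)%E).
  move=> mh h0 c0; have [mg' g0'] := nnmfun_mweight i mh h0 mw.
  split; last by move=> w; rewrite mule_ge0.
  by apply: emeasurable_funM => //; exact: measurable_cst.
have half (h : R -> R) : (forall t, 0 <= h t) -> 0 <= h r / 2.
  by move=> h0; rewrite divr_ge0.
rewrite iintD//; [|exact: mZ (half _ gp0)|exact: mZ (half _ gm0)].
rewrite !iintZ//; try exact: half; try exact: nnmfun_mweight.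
rewrite -/(int_others `[a, b] i r _) -/(wint a b i gp r _).
rewrite -/(int_others `[a, b] i r _) -/(wint a b i gm r _).
rewrite -[wint a b i gp r _]fineK; last exact: (wint_fin i mgp gp0 gp1 r mw).
rewrite -[wint a b i gm r _]fineK; last exact: (wint_fin i mgm gm0 gm1 r mw).
rewrite -!EFinM -EFinD -/(interim gp x r) -/(interim gm x r); congr EFin.
by rewrite gpE// gmE//; field.
Qed.


Lemma s_minE tau : s_min a b gp gm i tau = cutoff p q tau.
Proof.
(* Each density is 2 f s or 2 f (1 - s) on the support, so the integrals in [s_min] are tails
   divided by c = 2^(n-1), which cancels in the quotient. *)
pose c : R := \prod_(k < n | k != i) 2.
have c0 : 0 < c by apply: prodr_gt0.
pose I v : R := (LR_others_ge i v tau)%:R.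
have mI : mweight I by exact: mweight_LR.
have mp := nnmfun_mweight i mgp gp0 mI.
have mm := nnmfun_mweight i mgm gm0 mI.
have numE : int_others `[a, b] i 0 (fun v =>
    (prod_others i (fun s => (1 - s) * f s) v * I v)%:E) = (c^-1 * q tau)%:E.
  rewrite EFinM -(tailE i mgm gm0 gm1 0) -iintZ// ?invr_ge0 ?ltW//.
  apply: eq_iint => w /reach_others[wab _]; rewrite -EFinM; congr EFin.
  have -> : prod_others i gm w = c * prod_others i (fun s => (1 - s) * f s) w.
    rewrite /prod_others /c -big_split /=; apply: eq_bigr => k ki.
    by rewrite gmE ?in_itv /= ?wab//; ring.
  by rewrite -mulrA mulKf// gt_eqF.
have denE : int_others `[a, b] i 0 (fun v =>
    ((prod_others i (fun s => s * f s) v +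
      prod_others i (fun s => (1 - s) * f s) v) * I v)%:E) =
    (c^-1 * (p tau + q tau))%:E.
  rewrite EFinM EFinD -(tailE i mgm gm0 gm1 0) -(tailE i mgp gp0 gp1 0).
  rewrite -iintD//.
  have mD : nnmfun (fun w => ((prod_others i gp w * I w)%:E +
      (prod_others i gm w * I w)%:E)%E : \bar R).
    split; last by move=> w; apply: adde_ge0; [exact: (proj2 mp)|exact: (proj2 mm)].
    by apply: emeasurable_funD; [exact: (proj1 mp)|exact: (proj1 mm)].
  rewrite -iintZ// ?invr_ge0 ?ltW//.
  apply: eq_iint => w /reach_others[wab _]; rewrite -EFinD -EFinM; congr EFin.
  have -> : prod_others i gm w = c * prod_others i (fun s => (1 - s) * f s) w.
    rewrite /prod_others /c -big_split /=; apply: eq_bigr => k ki.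
    by rewrite gmE ?in_itv /= ?wab//; ring.
  have -> : prod_others i gp w = c * prod_others i (fun s => s * f s) w.
    rewrite /prod_others /c -big_split /=; apply: eq_bigr => k ki.
    by rewrite gpE ?in_itv /= ?wab//; ring.
  by field; rewrite gt_eqF.
rewrite /s_min numE denE /= /cutoff invfM invrK.
by rewrite mulrACA mulVf ?mul1r// gt_eqF.
Qed.

Lemma x_star_mech tau : mech_comp a b (x_star a b gp gm i tau).
Proof.
split; last first.
  move=> s _; rewrite /x_star; case: ifP => _; first by rewrite lexx ler01.
  by case: ifP => _; [case: LR_others_ge|case: LR_all_ge1];
    rewrite /= ?ler01 lexx.
apply: measurable_funTS; apply: measurable_fun_ifT.
- by apply: measurable_fun_ler => //; exact: measurable_tnth.
- exact: measurable_cst.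
apply: measurable_fun_ifT.
- by apply: measurable_fun_ler => //; exact: measurable_tnth.
- exact: (proj1 (mweight_LR i tau)).
apply: measurable_natr; apply: measurable_fun_ler; apply: measurable_prod_all => //.
exact: measurable_funB.
Qed.

Hypothesis tail_cutoff_ge0 : forall tau, 0 <= cutoff p q tau.

Lemma interim_x_star (h : R -> R) tau t : measurable_fun setT h ->
  (forall s, 0 <= h s) -> (\int[mu]_(s in `[a, b]) (h s)%:E = 1)%E ->
  t \in `[a, b] ->
  interim h (x_star a b gp gm i tau) t = menu p q (tail a b i h) tau t.
Proof.
move=> mh h0 h1 tI; apply: EFin_inj.
rewrite -interimE//; last exact: x_star_mech.
have xE phi : (forall w, reach `[a, b] (fun k => k == val i) n (fun=> t) w ->
      x_star a b gp gm i tau (tup w) = phi w) ->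
    int_others `[a, b] i t
      (fun v => (prod_others i h v * x_star a b gp gm i tau (tup v))%:E) =
    wint a b i h t phi.
  by move=> xphi; apply: eq_iint => w /xphi ->.
rewrite /menu; case: (leP t (cutoff p q tau)) => tc.
  rewrite (xE (fun=> 0)) ?wint0// => w /reach_others[_ wi].
  by rewrite /x_star tnth_tup wi s_minE tc.
(* Positivity allows the test LR(s_i, s_{-i}) >= 1 to be divided by t in the last branch. *)
have t0 : 0 < t by exact: le_lt_trans (tail_cutoff_ge0 tau) tc.
case: (leP t (s_max tau)) => tm.
  rewrite -(tailE i mh h0 h1 t); apply: xE => w /reach_others[_ wi].
  by rewrite /x_star tnth_tup wi s_minE leNgt tc /= tm.
rewrite -(tailE i mh h0 h1 t); apply: xE => w /reach_others[_ wi].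
rewrite /x_star tnth_tup wi s_minE leNgt tc /= leNgt tm /=; congr (nat_of_bool _)%:R.
rewrite /LR_all_ge1 /LR_others_ge !(prod_allE _ i) wi.
by rewrite mulrAC ler_pdivrMr// [X in _ = (_ <= X)]mulrC.
Qed.

End Mechanisms.

(** * A symmetric log-concave density is unimodal around 1/2 *)

Section Density.
Context {R : realType}.
Set Implicit Arguments. Unset Strict Implicit.
Variables (gp gm : R -> R) (a b : R).
Hypotheses (hab : a < b)
  (supp_out : forall s, s \notin `[a, b] -> dens gp gm s = 0)
  (supp_in : forall s, s \in `[a, b] -> 0 < dens gp gm s)
  (logconcave : forall x y l, x \in `[a, b] -> y \in `[a, b] ->
     0 <= l <= 1 ->
     l * ln (dens gp gm x) + (1 - l) * ln (dens gp gm y)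
       <= ln (dens gp gm (l * x + (1 - l) * y)))
  (symmetric : forall s, dens gp gm s = dens gp gm (1 - s)).

Lemma support_reflect s : s \in `[a, b] -> 1 - s \in `[a, b].
Proof.
move=> sI; apply: contraT => /supp_out; rewrite -symmetric => e.
by have := supp_in sI; rewrite e ltxx.
Qed.

Lemma support_endpoints : a + b = 1.
Proof.
have /support_reflect : a \in `[a, b] by rewrite in_itv /= lexx ltW.
have /support_reflect : b \in `[a, b] by rewrite in_itv /= lexx ltW.
rewrite !in_itv /= => /andP[h1 _] /andP[_ h2].
by apply/eqP; rewrite eq_le; apply/andP; split; lra.
Qed.

(* t lies between s and 1 - s, where the density takes the same value. *)
Lemma dens_incr s t : a <= s -> s <= t -> t <= 1 / 2 ->
  dens gp gm s <= dens gp gm t.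
Proof.
move=> as_ st t2; have := support_endpoints => abE.
have [->//|ts] := eqVneq s t.
have {ts}st : s < t by rewrite lt_neqAle ts.
have sI : s \in `[a, b] by rewrite in_itv /= as_ /=; lra.
have tI : t \in `[a, b] by rewrite in_itv /= (le_trans as_ (ltW st)) /=; lra.
pose l := (1 - s - t) / (1 - 2 * s).
have s2 : 0 < 1 - 2 * s by lra.
have l01 : 0 <= l <= 1 by rewrite /l divr_ge0 ?ler_pdivrMr//; lra.
have := logconcave sI (support_reflect sI) l01; rewrite -symmetric.
have -> : l * s + (1 - l) * (1 - s) = t by rewrite /l; field; rewrite gt_eqF.
by rewrite -mulrDl subrKC mul1r ler_ln ?posrE ?supp_in.
Qed.

Lemma dens_decr s t : 1 / 2 <= s -> s <= t -> t <= b ->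
  dens gp gm t <= dens gp gm s.
Proof.
move=> s2 st tb; have := support_endpoints => abE.
by rewrite symmetric [leRHS]symmetric; apply: dens_incr; lra.
Qed.

End Density.

Theorem theorem2 (R : realType) (n : nat) (hn : (2 <= n)%N)
  (gp gm : R -> R) (a b : R)
  (ha : 0 <= a) (hab : a < b) (hb : b <= 1)
  (gp_ge0 : forall s, 0 <= gp s) (gm_ge0 : forall s, 0 <= gm s)
  (gp_meas : measurable_fun setT gp) (gm_meas : measurable_fun setT gm)
  (gp_prob : (\int[lebesgue_measure]_(s in setT) (gp s)%:E = 1)%E)
  (gm_prob : (\int[lebesgue_measure]_(s in setT) (gm s)%:E = 1)%E)
  (supp_out : forall s, s \notin `[a, b] -> dens gp gm s = 0)
  (supp_in : forall s, s \in `[a, b] -> 0 < dens gp gm s)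
  (normalized : forall s, s \in `[a, b] -> gp s = s * (gp s + gm s))
  (regular : exists df : R -> R,
     {within `[a, b], continuous df} /\
     (forall s, s \in `]a, b[ -> is_derive s 1 (dens gp gm) (df s)) /\
     exists M : R, forall s, s \in `[a, b] -> `|df s / dens gp gm s| <= M)
  (logconcave : forall x y l, x \in `[a, b] -> y \in `[a, b] ->
     0 <= l <= 1 ->
     l * ln (dens gp gm x) + (1 - l) * ln (dens gp gm y)
       <= ln (dens gp gm (l * x + (1 - l) * y)))
  (symmetric : forall s, dens gp gm s = dens gp gm (1 - s)) :
  forall i : 'I_n, exists tau : R, 0 <= tau /\
    optimal_for a b gp gm i (x_star a b gp gm i tau) /\
    (forall s, x_star a b gp gm i tau s = 0 \/ x_star a b gp gm i tau s = 1).
Proof.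
move=> i.
have abE := support_endpoints hab supp_out supp_in symmetric.
have gpm s : gp s + gm s = 2 * dens gp gm s by rewrite /dens; field.
have gpE s : s \in `[a, b] -> gp s = 2 * dens gp gm s * s.
  by move=> sI; rewrite normalized// gpm mulrC.
have gmE s : s \in `[a, b] -> gm s = 2 * dens gp gm s * (1 - s).
  by move=> sI; have := gpE s sI; have := gpm s; lra.
have out s : s \notin `[a, b] -> gp s = 0 /\ gm s = 0.
  move=> /supp_out e; have := gpm s; rewrite e mulr0 => /eqP.
  by rewrite paddr_eq0// => /andP[/eqP-> /eqP->].
have on_itv (h : R -> R) : (forall s, s \notin `[a, b] -> h s = 0) ->
    (\int[lebesgue_measure]_(s in setT) (h s)%:E = 1)%E ->
    (\int[lebesgue_measure]_(s in `[a, b]) (h s)%:E = 1)%E.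
  move=> h0 <-; rewrite integral_mkcond; apply: eq_integral => s _.
  rewrite patchE; case: ifPn => // sI; rewrite h0//.
  by apply: contra sI => sI; exact/mem_set.
have gp1 := on_itv gp (fun s sI => proj1 (out s sI)) gp_prob.
have gm1 := on_itv gm (fun s sI => proj2 (out s sI)) gm_prob.
have mf : measurable_fun setT (dens gp gm).
  by apply: measurable_funM => //; exact: measurable_funD.
have f0 s : 0 <= dens gp gm s by rewrite divr_ge0// addr_ge0.
pose p := tail a b i gp; pose q := tail a b i gm.
have p01 t : 0 <= p t <= 1 by rewrite tail_ge0//= tail_le1.
have q01 t : 0 <= q t <= 1 by rewrite tail_ge0//= tail_le1.
have p0 : p 0 = 1 by exact: tail0.
have q0 : q 0 = 1 by exact: tail0.
have pd : {homo p : s t / s <= t >-> t <= s} by exact: tail_nonincreasing.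
have qd : {homo q : s t / s <= t >-> t <= s} by exact: tail_nonincreasing.
(* Applied to another test this gives [pq_opt], to the zero weight [pq_ge0], and to a mechanism the
   bound on its interim rules. *)
have NP r phi t : 0 <= t -> mweight phi ->
    fine (wint a b i gp r phi) - t * fine (wint a b i gm r phi) <=
    p t - t * q t.
  by move=> t0 mphi; exact: (neyman_pearson i ha hb gp_ge0 gm_ge0 gp_meas gm_meas gp1 gm1 supp_in gpE gmE r t0 mphi).
have pq_opt s t : 0 <= t -> p s - t * q s <= p t - t * q t.
  move=> t0; have := NP 0 _ t t0 (mweight_LR i s).
  by rewrite !tailE.
have pq_ge0 t : 0 <= t -> 0 <= p t - t * q t.
  move=> t0; have m0 : mweight (n := n) (fun=> 0 : R) by split => // v; rewrite lexx ler01.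
  by have := NP 0 _ t t0 m0; rewrite !wint0//= mulr0 subr0.
have pc : continuous p by exact: continuous_tail.
have qc : continuous q by exact: continuous_tail.
have fincr := dens_incr hab supp_out supp_in logconcave symmetric.
have fdecr := dens_decr hab supp_out supp_in logconcave symmetric.
have [tau tau01 tau_opt] := optimal_menu ha hab hb abE mf f0 fincr fdecr
  pc qc p01 q01 pd qd p0 q0 pq_ge0 pq_opt.
have tau0 : 0 <= tau by case/andP: tau01.
exists tau; split => //; split; last first.
  move=> s; rewrite /x_star; case: ifP => _; first by left.
  by case: ifP => _; [case: LR_others_ge|case: LR_all_ge1]; [right|left|right|left].
have cge0 t : 0 <= cutoff p q t by exact: cutoff_ge0.
have mx := x_star_mech a b gp gm i tau.
set x := x_star a b gp gm i tau in mx *.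
have xp t : t \in `[a, b] -> interim a b i gp x t = menu p q p tau t.
  by move=> tI; exact: interim_x_star.
have xq t : t \in `[a, b] -> interim a b i gm x t = menu p q q tau t.
  by move=> tI; exact: interim_x_star.
have icx : incentive a b (menu p q p tau) (menu p q q tau).
  exact: menu_incentive.
have condx := condE_interim i gp_ge0 gm_ge0 gp_meas gm_meas gp1 gm1 supp_in gpE gmE.
split; first exact: mx.
split.
  split=> [t tI|t r tI rI]; rewrite !condx// lee_fin !xp// !xq//.
    by have [V0 _] := payoff_menu_ge p01 q01 pq_opt tau0 (itv01 ha hb tI).
  exact: icx.
move=> y my [y0 yic].
rewrite !(expected_interim i gp_ge0 gm_ge0 gp_meas gm_meas gp1 gm1 gpE gmE)//.
have ry := interim_rule i gp_meas gp_ge0 gp1 my.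
have ry' := interim_rule i gm_meas gm_ge0 gm1 my.
have rx := interim_rule i gp_meas gp_ge0 gp1 mx.
have rx' := interim_rule i gm_meas gm_ge0 gm1 mx.
rewrite -[leLHS]fineK; last first.
  by apply: integrable_fin_num => //; exact: (integrable_objective ha hb mf f0 fincr fdecr ry ry').
rewrite -[leRHS]fineK; last first.
  by apply: integrable_fin_num => //; exact: (integrable_objective ha hb mf f0 fincr fdecr rx rx').
rewrite lee_fin.
apply: (@le_trans _ _ (objective a b (dens gp gm) (menu p q p tau) (menu p q q tau))).
  apply: tau_opt => //.
  - by move=> t r tI rI; have := yic t r tI rI; rewrite !condx// lee_fin.
  - by move=> t tI; have := y0 t tI; rewrite !condx// lee_fin.
  - by move=> t s tI s0; apply: NP => //; exact: mweight_weight_of.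
by rewrite le_eqVlt; apply/orP; left; apply/eqP; apply: eq_Rintegral => t /set_mem tI;
  rewrite xp// xq.
Qed.
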